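(* Let $p$ be a prime and $F$ a field of characteristic $p$. Suppose that $G=G_+=\{g_1,\dots,g_r\}$ is a finite abelian group, and $L$ is a free color Lie $p$-algebra over $F$ freely generated by a set $X=X_{g_1}\cup\cdots\cup X_{g_r}$ with $|X_{g_i}|=s_i$, $1\le s_i<\infty$, $i=1,\dots,r$. Then: 1. $$H(L;t_1,\dots,t_r)=-\sum_{n=1}^{\infty}\frac{\mu_p(n)}{n}\ln\Bigl(1-\sum_{i=1}^{r}s_it_i^n\Bigr).$$ 2. For every $\alpha\in\mathbb{N}_0^r\setminus\{0\}$, $$\dim L_\alpha=\frac1{|\alpha|}\sum_{n\mid\alpha}\mu_p(n)\,\frac{\left(\frac{|\alpha|}{n}\right)!}{\left(\frac{\alpha_1}{n}\right)!\cdots\left(\frac{\alpha_r}{n}\right)!}\,s_1^{\frac{\alpha_1}{n}}\cdots s_r^{\frac{\alpha_r}{n}}.$$ 3. For every $n\ge1$ and $g\in G$, $$\dim L^{(n,g)}=\sum_{\substack{\alpha_1+\cdots+\alpha_r=n\\ g_1^{\alpha_1}\cdots g_r^{\alpha_r}=g}}\dim L_{(\alpha_1,\dots,\alpha_r)},$$ the sum being over $(\alpha_1,\dots,\alpha_r)\in\mathbb{N}_0^r$.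
   Context: $\mathbb{N}_0=\{0,1,2,\dots\}$; $\mu$ is the Möbius function. Define $\mu_p(n)=\mu(n)$ if $p\nmid n$, and $\mu_p(n)=\mu(m)(p^s-p^{s-1})$ if $n=mp^s$ with $p\nmid m$, $s\ge1$. Color Lie $p$-algebras: $G$ is an abelian group (written multiplicatively), $\gamma:G\times G\to F^{\times}$ a bicharacter with $\gamma(g,h)\gamma(h,g)=1$; $G_+=\{g:\gamma(g,g)=1\}$, here $G=G_+$. A color Lie algebra is a $G$-graded space $L=\bigoplus_gL_g$ with bilinear bracket, $[L_g,L_h]\subseteq L_{gh}$, such that for $x\in L_g,y\in L_h,z\in L$: $[x,y]=-\gamma(g,h)[y,x]$, $[x,[y,z]]=[[x,y],z]+\gamma(g,h)[y,[x,z]]$, and $[x,x]=0$. It is a color Lie $p$-algebra if for each $g\in G$ there is a map $L_g\to L_{g^p}$, $x\mapsto x^{[p]}$, with $(ax)^{[p]}=a^px^{[p]}$ ($a\in F$), $[x^{[p]},z]=(\mathrm{ad}\,x)^p(z)$ for all $z\in L$, and $(x+y)^{[p]}=x^{[p]}+y^{[p]}+\sum_{i=1}^{p-1}s_i(x,y)$ for $x,y\in L_g$, where $i\,s_i(x,y)$ is the coefficient of $t^{i-1}$ in $(\mathrm{ad}(tx+y))^{p-1}(x)$. The free color Lie $p$-algebra on a $G$-graded set $X=\bigcup_gX_g$ (elements of $X_g$ have $G$-degree $g$) is defined by the usual universal property for $G$-degree-preserving maps. Gradings: $L$ is $\mathbb{N}_0^r$-graded by giving each $x\in X_{g_i}$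 the weight $\lambda_i=(0,\dots,0,1,0,\dots,0)$ (1 in the $i$th place); brackets add weights and the $p$-map multiplies weight by $p$. $L_\alpha$ is the component of multidegree $\alpha$, $|\alpha|=\alpha_1+\cdots+\alpha_r$, and $H(L;t_1,\dots,t_r)=\sum_{\alpha\ne0}(\dim L_\alpha)t_1^{\alpha_1}\cdots t_r^{\alpha_r}$. $n\mid\alpha$ means that the positive integer $n$ divides all $\alpha_i$. $L^{(n,g)}$ is the component of degree $(n,g)$ for the $\mathbb{N}\times G$-grading of $L$ in which each $x\in X_{g_i}$ has degree $(1,g_i)$. *)

(* Defs.v *)
From HB Require Import structures.
From mathcomp Require Import all_boot all_order all_algebra all_fingroup.
From mathcomp Require Import mpoly.

Set Implicit Arguments.
Unset Strict Implicit.
Unset Printing Implicit Defensive.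

Import GRing.Theory Num.Theory.
Local Open Scope ring_scope.

Definition mobius (n : nat) : int :=
  if (0 < n)%N && all (fun q => logn q n == 1%N) (primes n)
  then (-1) ^+ size (primes n) else 0.

Definition mobius_p (p n : nat) : int :=
  if (p %| n)%N then
    let s := logn p n in
    mobius (n %/ p ^ s) * ((p ^ s)%:Z - (p ^ s.-1)%:Z)
  else mobius n.

(* Formal power series over rat in t_1, ..., t_r, given by their coefficients. *)
Definition mseries (r : nat) := 'X_{1..r} -> rat.

(* S = \sum_(n >= 1) f n in the product topology: every coefficient of the
   partial sums is eventually constant. *)
Definition series_sum1 (r : nat) (f : nat -> mseries r) (S : mseries r) : Prop :=
  forall a : 'X_{1..r}, exists N : nat, forall m : nat, (N <= m)%N ->
    \sum_(1 <= n < m) f n a = S a.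

(* ln (1 - u) = - \sum_(k >= 1) u^k / k for a polynomial u with no constant
   term; the terms with k > |a| do not contribute to the coefficient of t^a
   (see [log1mE]). *)
Definition log1m (r : nat) (u : {mpoly rat[r]}) : mseries r :=
  fun a => - \sum_(1 <= k < (mdeg a).+1) (u ^+ k)@_a / k%:R.

Definition hilbert_series (r : nat) (d : 'X_{1..r} -> nat) : mseries r :=
  fun a => if a == 0%MM then 0 else (d a)%:R.

Section Dimension.
Variables (F : fieldType) (V : lmodType F).

(* P is a subset of V with a basis of d elements; V itself may be
   infinite-dimensional. *)
Definition has_dim (P : V -> Prop) (d : nat) : Prop :=
  exists b : 'I_d -> V,
    [/\ forall i, P (b i),
        forall c : 'I_d -> F, \sum_i c i *: b i = 0 -> forall i, c i = 0
      & forall v, P v -> exists c : 'I_d -> F, v = \sum_i c i *: b i].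

Definition is_subspace (P : V -> Prop) : Prop :=
  P 0 /\ forall (a : F) (u v : V), P u -> P v -> P (a *: u + v).

Definition direct_sum (I : finType) (P : I -> V -> Prop) : Prop :=
  (forall v, exists2 u : I -> V, (forall i, P i (u i)) & v = \sum_i u i)
  /\ (forall u : I -> V, (forall i, P i (u i)) ->
        \sum_i u i = 0 -> forall i, u i = 0).

(* For a bracket br extended to V[t], the coefficient of t^j in
   (ad (t x + y))^k (z). *)
Fixpoint ad_coef (br : V -> V -> V) (x y z : V) (k j : nat) {struct k} : V :=
  match k with
  | 0 => if j == 0%N then z else 0
  | k'.+1 => (if j is j'.+1 then br x (ad_coef br x y z k' j') else 0)
             + br y (ad_coef br x y z k' j)
  end.

(* i s_i(x, y) is the coefficient of t^(i-1) in (ad (t x + y))^(p-1) (x). *)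
Definition jacobson_s (p : nat) (br : V -> V -> V) (i : nat) (x y : V) : V :=
  (i%:R : F)^-1 *: ad_coef br x y x p.-1 i.-1.

End Dimension.

Definition skew_bicharacter (F : fieldType) (G : finGroupType)
    (gamma : G -> G -> F) : Prop :=
  [/\ forall g h, gamma g h != 0,
      forall g h k, gamma (g * h)%g k = gamma g k * gamma h k,
      forall g h k, gamma g (h * k)%g = gamma g h * gamma g k
    & forall g h, gamma g h * gamma h g = 1].

(* Color Lie algebras for G = G_+. *)
Record colorLie (F : fieldType) (G : finGroupType) (gamma : G -> G -> F) :=
  ColorLie {
    cl_sort :> lmodType F;
    cl_comp : G -> cl_sort -> Prop;
    cl_br : cl_sort -> cl_sort -> cl_sort;
    cl_comp_sub : forall g, is_subspace (cl_comp g);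
    cl_comp_direct : direct_sum cl_comp;
    cl_br_linearl : forall y, linear (cl_br ^~ y);
    cl_br_linearr : forall x, linear (cl_br x);
    cl_br_comp : forall g h x y, cl_comp g x -> cl_comp h y ->
      cl_comp (g * h)%g (cl_br x y);
    cl_br_skew : forall g h x y, cl_comp g x -> cl_comp h y ->
      cl_br x y = - (gamma g h *: cl_br y x);
    cl_br_jacobi : forall g h x y z, cl_comp g x -> cl_comp h y ->
      cl_br x (cl_br y z)
        = cl_br (cl_br x y) z + gamma g h *: cl_br y (cl_br x z);
    cl_br_alt : forall g x, cl_comp g x -> cl_br x x = 0
  }.

(* clp_pmap g is the map L_g -> L_(g^p); its values outside L_g are
   irrelevant. *)
Record colorLieP (F : fieldType) (p : nat) (G : finGroupType)
    (gamma : G -> G -> F) :=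
  ColorLieP {
    clp_lie :> colorLie gamma;
    clp_pmap : G -> clp_lie -> clp_lie;
    clp_pmap_comp : forall g x, cl_comp g x ->
      cl_comp (g ^+ p)%g (clp_pmap g x);
    clp_pmapZ : forall g (a : F) x, cl_comp g x ->
      clp_pmap g (a *: x) = a ^+ p *: clp_pmap g x;
    clp_pmap_ad : forall g x z, cl_comp g x ->
      cl_br (clp_pmap g x) z = iter p (cl_br x) z;
    clp_pmapD : forall g x y, cl_comp g x -> cl_comp g y ->
      clp_pmap g (x + y) = clp_pmap g x + clp_pmap g y
        + \sum_(1 <= i < p) jacobson_s p (@cl_br F G gamma clp_lie) i x y
  }.

Section Free.
Variables (F : fieldType) (p : nat) (G : finGroupType) (gamma : G -> G -> F).

Definition is_clp_hom (L M : colorLieP p gamma) (f : L -> M) : Prop :=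
  [/\ linear f,
      forall g x, cl_comp g x -> cl_comp g (f x),
      forall x y, f (cl_br x y) = cl_br (f x) (f y)
    & forall g x, cl_comp g x -> f (clp_pmap g x) = clp_pmap g (f x)].

Definition is_free_clp (X : Type) (deg : X -> G)
    (L : colorLieP p gamma) (iota : X -> L) : Prop :=
  (forall x, cl_comp (deg x) (iota x)) /\
  forall (M : colorLieP p gamma) (phi : X -> M),
    (forall x, cl_comp (deg x) (phi x)) ->
    exists f : L -> M,
      [/\ is_clp_hom f, forall x, f (iota x) = phi x
        & forall f' : L -> M, is_clp_hom f' ->
            (forall x, f' (iota x) = phi x) -> f' =1 f].

(* Let (W, op) be a commutative monoid with p-th power map pw.  When the
   generators iota x are given the weights wt x, [weight_comp a] is the
   component of weight a of the resulting W-grading: the span of the elements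
   of weight a obtained from generators by brackets, which multiply weights,
   and p-maps, which raise weights to the p-th power. *)
Inductive weight_comp (W : Type) (op : W -> W -> W) (pw : W -> W)
    (X : Type) (wt : X -> W) (L : colorLieP p gamma) (iota : X -> L) :
    W -> L -> Prop :=
| wc_gen x : weight_comp op pw wt iota (wt x) (iota x)
| wc_zero a : weight_comp op pw wt iota a 0
| wc_lin a (c : F) u v :
    weight_comp op pw wt iota a u -> weight_comp op pw wt iota a v ->
    weight_comp op pw wt iota a (c *: u + v)
| wc_br a b u v :
    weight_comp op pw wt iota a u -> weight_comp op pw wt iota b v ->
    weight_comp op pw wt iota (op a b) (cl_br u v)
| wc_pmap a g u :
    cl_comp g u -> weight_comp op pw wt iota a u ->
    weight_comp op pw wt iota (pw a) (clp_pmap g u).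

Variables (X : Type) (deg : X -> G) (L : colorLieP p gamma) (iota : X -> L).

(* L_a, where x in X_(g_i) has weight (0, ..., 1, ..., 0), 1 in place i. *)
Definition multidegree_comp (r : nat) (g : 'I_r -> G) :
    'X_{1..r} -> L -> Prop :=
  weight_comp (fun a b => (a + b)%MM) (fun a => (a *+ p)%MM)
    (fun x => [multinom nat_of_bool (deg x == g i) | i < r]) iota.

(* L^(n,h), where x in X_(g_i) has degree (1, g_i). *)
Definition degree_comp : nat * G -> L -> Prop :=
  weight_comp (fun a b => ((a.1 + b.1)%N, (a.2 * b.2)%g))
    (fun a => ((p * a.1)%N, (a.2 ^+ p)%g)) (fun x => (1%N, deg x)) iota.

End Free.

Lemma mcoeff_expr_small (r : nat) (u : {mpoly rat[r]}) (k : nat)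
    (a : 'X_{1..r}) : u@_0%MM = 0 -> (mdeg a < k)%N -> (u ^+ k)@_a = 0.
Proof.
move=> u0; elim: k a => [|k IHk] a // ltak.
rewrite exprS mcoeffM big1 // => -[b c] /= /eqP def_a.
have [b0|nz_b] := eqVneq (bmnm b) 0%MM; first by rewrite b0 u0 mul0r.
rewrite IHk ?mulr0 //; rewrite def_a mdegD in ltak.
rewrite -ltnS; apply: leq_ltn_trans ltak.
by rewrite -add1n leq_add2r lt0n mdeg_eq0.
Qed.

Lemma log1mE (r : nat) (u : {mpoly rat[r]}) : u@_0%MM = 0 ->
  series_sum1 (fun k a => - ((u ^+ k)@_a / k%:R)) (log1m u).
Proof.
move=> u0 a; exists (mdeg a).+1 => m le_am.
rewrite (@big_cat_nat _ _ _ (mdeg a).+1) //= [X in _ + X]big_nat_cond.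
rewrite [X in _ + X]big1 ?addr0 ?sumrN // => k /andP[/andP[ltak _] _].
by rewrite mcoeff_expr_small // mul0r oppr0.
Qed.

(* Main.v *)
Require Import Defs.
From HB Require Import structures.
From mathcomp Require Import all_boot all_order all_algebra all_fingroup.
From mathcomp Require Import mpoly.
From mathcomp Require Import zify ring.

(** Each component of [L] has a basis indexed by the words [l^(p^k)] over [X],
    for [l] a Lyndon word and [k >= 0].

    Order the letters and bracket a Lyndon word [w] along its standard
    factorization [w = uv], where [v] is the smallest proper suffix: this gives
    [P_w = [P_u, P_v]]. The elements [P_l^[p^k]], for [l] a Lyndon word and
    [k >= 0], form a basis of [L], and [P_l^[p^k]] is attached to the word
    [l^(p^k)].

    They span ([weight_comp_span]): the bracket of two Lyndon elements is a
    combination of Lyndon elements ([br_lyndon_lower], by the Jacobi identity),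
    [ad (P_l^[p^k])] is a power of [ad P_l], and the p-map is additive up to
    brackets. This respects every grading in which the weight of a word
    determines its degree in [G], so one argument covers the multidegree and
    the pairs of a length and a degree in [G].

    They are independent ([lyndon_pow_indep]): [L] maps to an algebra of
    matrices, in which a letter acts by left multiplication on the words of
    length at most [N]. A graded matrix algebra is a color Lie p-algebra for the
    color commutator and the p-th power ([mx_colorLieP]); this rests on
    Jacobson's formula ([jacobson_formula]) and on the p-th power of a twisted
    commutator ([iter_twisted_pchar]). The smallest word in the image of
    [P_l^[p^k]] is [l^(p^k)], so elements attached to distinct words of length
    [N] are independent. The universal property of [L] is only used to obtain
    this map.

    It remains to count the words [l^(p^k)] of content [a]. Every nonempty word
    is a rotation of [l^d] for a unique Lyndon word [l] and a unique [d > 0], and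
    [l^d] has [|l|] rotations ([card_rotations]). The number of words of content
    [a] is therefore a divisor sum, and Mobius inversion applies because the sum
    of [mu_p] over the divisors of [e] is [e] if [e] is a power of [p] and 0
    otherwise ([sum_mobius_p]). This gives the dimension formula. The
    coefficients of the logarithms in the Hilbert series are the same multinomial
    terms ([log1m_upoly]), and the component of degree [(n, h)] is found by
    sorting the words of length [n] and degree [h] by content
    ([card_ppow_lyndon_deg]). *)

Set Implicit Arguments.
Unset Strict Implicit.
Unset Printing Implicit Defensive.

Import GRing.Theory Num.Theory.
Local Open Scope ring_scope.

(** * Lyndon words *)

Section LyndonWords.
Variable X : finType.
Implicit Types (u v w s t l m : seq X) (x y : X).
Local Open Scope nat_scope.

(** The strict lexicographic order on words, a proper prefix being smaller;
    letters are compared by their rank in the enumeration of [X]. *)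
Fixpoint lexlt u v : bool :=
  match u, v with
  | _, [::] => false
  | [::], _ :: _ => true
  | x :: u', y :: v' =>
      (enum_rank x < enum_rank y) || (x == y) && lexlt u' v'
  end.

Lemma lexlt_irr u : lexlt u u = false.
Proof. by elim: u => //= x u ->; rewrite ltnn andbF. Qed.

Lemma lexlt_trans : transitive lexlt.
Proof.
move=> v u w; elim: u v w => [|x u IH] [|y v] [|z w] //=.
case/orP=> [ltxy|/andP[/eqP-> ltuv]] /orP[ltyz|/andP[/eqP<- ltvw]].
- by rewrite (ltn_trans ltxy ltyz).
- by rewrite ltxy.
- by rewrite ltyz.
- by rewrite eqxx (IH _ _ ltuv ltvw) orbT.
Qed.

Lemma lexlt_total u v : [\/ u = v, lexlt u v | lexlt v u].
Proof.
elim: u v => [|x u IH] [|y v] /=; first by constructor 1.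
- by constructor 2.
- by constructor 3.
case: (ltngtP (enum_rank x) (enum_rank y)) => [lt|lt|/val_inj/enum_rank_inj->].
- by constructor 2.
- by constructor 3.
rewrite eqxx /=.
by case: (IH v) => [->|lt|lt]; [constructor 1|constructor 2|constructor 3].
Qed.

Lemma lexltNge u v : u != v -> ~~ lexlt u v -> lexlt v u.
Proof. by case: (lexlt_total u v) => [->|->|//]; rewrite ?eqxx. Qed.

Lemma lexlt_cat2l s u v : lexlt (s ++ u) (s ++ v) = lexlt u v.
Proof. by elim: s => //= x s ->; rewrite ltnn eqxx. Qed.

Lemma lexlt_catr u v s : lexlt u v -> lexlt u (v ++ s).
Proof.
elim: u v => [|x u IH] [|y v] //= /orP[->//|/andP[-> /IH->]].
by rewrite orbT.
Qed.

Lemma lexlt_prefix u s : s <> [::] -> lexlt u (u ++ s).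
Proof. by move=> s0; rewrite -{1}[u]cats0 lexlt_cat2l; case: s s0. Qed.

(** Two words that differ before either ends compare like any of their
    extensions. *)
Lemma lexlt_cat u v s t :
  lexlt u v -> (forall z, v <> u ++ z) -> lexlt (u ++ s) (v ++ t).
Proof.
elim: u v => [|x u IH] [|y v] //=; first by move=> _ /(_ (y :: v)).
case/orP=> [->//|/andP[/eqP-> ltuv]] npre; rewrite eqxx ltnn /=.
by apply: IH => // z def_v; apply: (npre z); rewrite def_v.
Qed.

Lemma lexlt_cat_size u v s t :
  lexlt u v -> size v <= size u -> lexlt (u ++ s) (v ++ t).
Proof.
move=> ltuv le_vu; apply: lexlt_cat => // z def_v.
move: le_vu ltuv; rewrite def_v size_cat.
have [->|] := eqVneq z [::]; first by rewrite cats0 lexlt_irr.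
by case: z {def_v} => //= x z _; rewrite -{2}[size u]addn0 leq_add2l.
Qed.

(** A Lyndon word: nonempty, and smaller than each of its proper nonempty
    suffixes. *)
Definition lyndon w :=
  (w != [::]) && all (fun i => lexlt w (drop i w)) (iota 1 (size w).-1).

Lemma lyndonP w :
  reflect (w <> [::] /\
           forall s t, w = s ++ t -> s <> [::] -> t <> [::] -> lexlt w t)
          (lyndon w).
Proof.
apply: (iffP andP) => [[/eqP w0 /allP ltw]|[w0 ltw]].
  split=> // s t def_w s0 t0; have := ltw (size s).
  rewrite {3}def_w drop_size_cat //; apply.
  rewrite mem_iota def_w size_cat.
  by case: s t s0 t0 {def_w ltw} => [|? ?] [|? ?] //= _ _; lia.
split; first exact/eqP.
apply/allP=> i; rewrite mem_iota => i_bnd.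
have ltiw: i < size w by move: i_bnd; case: (w) w0 => //= *; lia.
apply: (ltw (take i w)); first by rewrite cat_take_drop.
  by move/(congr1 size); rewrite size_take ltiw /=; lia.
by move/(congr1 size); rewrite size_drop /=; lia.
Qed.

Lemma lyndon_neq0 w : lyndon w -> w <> [::].
Proof. by case/lyndonP. Qed.

Lemma lyndon_size w : lyndon w -> 0 < size w.
Proof. by case: w => // /lyndon_neq0. Qed.

(** If [u] is a prefix of [v], the comparison reduces to that of [v] with one
    of its suffixes. *)
Lemma lyndon_cat_ltr u v : lyndon v -> u <> [::] -> lexlt u v ->
  lexlt (u ++ v) v.
Proof.
move=> /lyndonP[v0 Lv] u0 ltuv.
have [/existsP[i /eqP def_v]|npre] :=
    boolP [exists i : 'I_(size v).+1, v == u ++ drop i v].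
  rewrite [X in lexlt _ X]def_v lexlt_cat2l; apply: (Lv u) => // z0.
  by move: ltuv; rewrite def_v z0 cats0 lexlt_irr.
rewrite -[X in lexlt _ X]cats0; apply: lexlt_cat => // z def_v.
case/existsP: npre; have ltuv1: size u < (size v).+1.
  by rewrite def_v size_cat ltnS leq_addr.
by exists (Ordinal ltuv1); rewrite {1}def_v eqseq_cat //= def_v drop_size_cat ?eqxx.
Qed.

Lemma cat_eq_cat u v s t : u ++ v = s ++ t -> size u <= size s ->
  exists2 z, s = u ++ z & v = z ++ t.
Proof.
elim: u s => [|x u IH] [|y s] //=; [by exists [::] | by exists (y :: s)|].
case=> -> E; rewrite ltnS => /(IH _ E)[z -> ->].
by exists z.
Qed.

Lemma lyndon_cat u v : lyndon u -> lyndon v -> lexlt u v -> lyndon (u ++ v).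
Proof.
move=> Lu Lv ltuv; have u0 := lyndon_neq0 Lu.
have lt_uv_v := lyndon_cat_ltr Lv u0 ltuv.
apply/lyndonP; split=> [|s t]; first by case: (u) u0.
have /lyndonP[_ {}Lv] := Lv; have /lyndonP[_ {}Lu] := Lu.
move=> def_uv s0 t0; have [le_us|lt_su] := leqP (size u) (size s).
  have [z def_s def_v] := cat_eq_cat def_uv le_us.
  have [z0|/eqP z1] := eqVneq z [::]; first by rewrite def_v z0 in lt_uv_v *.
  exact: lexlt_trans lt_uv_v (Lv _ _ def_v z1 t0).
have [z def_u def_t] := cat_eq_cat (esym def_uv) (ltnW lt_su).
have z0 : z <> [::].
  by move=> z0; move: lt_su; rewrite def_u z0 cats0 ltnn.
rewrite def_t; apply: lexlt_cat_size; first exact: Lu def_u s0 z0.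
by rewrite def_u size_cat leq_addl.
Qed.

(** The smallest nonempty suffix of a nonempty word. *)
Fixpoint minsuf w :=
  if w is x :: s then
    if s is [::] then w else if lexlt w (minsuf s) then w else minsuf s
  else w.

Lemma minsufP w : w <> [::] ->
  [/\ minsuf w <> [::], exists s, w = s ++ minsuf w
    & forall s t, w = s ++ t -> t <> [::] ->
        t = minsuf w \/ lexlt (minsuf w) t].
Proof.
elim: w => // x [|y w] IH _.
  split=> //; first by exists [::].
  by move=> [|? s] t /=; [move=> -> _; left | case: s t => [|? ?] [|? ?] [] ].
have [//|m0 [s0 def_m] min_m] := IH.
rewrite [minsuf _]/=; set m := minsuf (y :: w) in m0 def_m min_m *.
rewrite -/(lexlt (x :: y :: w) m); case: ifP => [ltm|nltm].
  split=> //; first by exists [::].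
  move=> [|a s] t /=; first by move=> <-; left.
  case=> _ def_t t0; right; case: (min_m s t def_t t0) => [->//|].
  exact: lexlt_trans ltm.
split=> //; first by exists (x :: s0); rewrite /= -def_m.
move=> [|a s] t /=; last by case=> _; exact: min_m.
move=> <- _; have [->|ne] := eqVneq (x :: y :: w) m; first by left.
by right; apply: lexltNge; rewrite // nltm.
Qed.

(** The standard factorization of a word [w] of length at least 2: [w] is
    [stdl w ++ stdr w], where [stdr w] is the smallest proper nonempty suffix. *)
Definition stdr w := minsuf (behead w).
Definition stdl w := take (size w - size (stdr w)) w.

Lemma std_spec w : 1 < size w ->
  [/\ w = stdl w ++ stdr w, stdl w <> [::], stdr w <> [::]
    & forall s t, w = s ++ t -> s <> [::] -> t <> [::] ->
        t = stdr w \/ lexlt (stdr w) t].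
Proof.
case: w => [|x [|y w]] // _; rewrite /stdl /stdr [behead _]/=.
have [//|m0 [s def_m] min_m] := @minsufP (y :: w).
set m := minsuf _ in m0 def_m min_m *.
have ->: take (size (x :: y :: w) - size m) (x :: y :: w) = x :: s.
  have ->: size (x :: y :: w) - size m = size (x :: s).
    by have := congr1 size def_m; rewrite size_cat /=; lia.
  by rewrite def_m -cat_cons take_size_cat.
split=> //; first by rewrite /= -def_m.
by case=> [|a s'] t //= [_]; move/min_m.
Qed.

Lemma std_size w : 1 < size w ->
  (0 < size (stdl w) < size w) && (0 < size (stdr w) < size w).
Proof.
case/std_spec=> def_w l0 r0 _; have := congr1 size def_w; rewrite size_cat.
case: (stdl w) (stdr w) l0 r0 => [|? ?] [|? ?] //= _ _; lia.
Qed.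

(** The standard factors of a Lyndon word are Lyndon words, in increasing
    order. *)
Lemma std_lyndon w : lyndon w -> 1 < size w ->
  [/\ lyndon (stdl w), lyndon (stdr w) & lexlt (stdl w) (stdr w)].
Proof.
move=> /lyndonP[w0 Lw] /std_spec[].
set u := stdl w; set v := stdr w => def_w u0 v0 min_v.
have ltwv : lexlt w v by apply: Lw def_w u0 v0.
split.
- apply/lyndonP; split=> // s t def_u s0 t0.
  have ne_tv: t ++ v <> [::] by case: (t) t0.
  have def_w1 : w = s ++ (t ++ v) by rewrite catA -def_u.
  have lt_w_tv : lexlt w (t ++ v) by apply: Lw def_w1 _ _.
  have ne_tu : t != u.
    apply/eqP=> /(congr1 size); rewrite def_u size_cat.
    by case: (s) s0 => //= *; lia.
  apply/negPn/negP=> nlt; have lt_tu : lexlt t u.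
    by apply: lexltNge nlt; rewrite eq_sym.
  have [/existsP[i /eqP def_u1]|npre] :=
      boolP [exists i : 'I_(size u).+1, u == t ++ drop i u].
    (* [t] is both a prefix and a suffix of [u] *)
    set z := drop i u in def_u1.
    have lt_zv : lexlt (z ++ v) v.
      by move: lt_w_tv; rewrite def_w {1}def_u1 -catA lexlt_cat2l.
    have zv0 : z ++ v <> [::] by case: (z) (v) v0 => //= -[].
    have := min_v t (z ++ v); rewrite catA -def_u1 => /(_ def_w t0 zv0) [].
      by move=> E; rewrite E lexlt_irr in lt_zv.
    by move/(lexlt_trans lt_zv); rewrite lexlt_irr.
  have := @lexlt_cat t u v v lt_tu; rewrite -def_w => H.
  have /(lexlt_trans lt_w_tv) : lexlt (t ++ v) w.
    apply: H => z def_u1; case/existsP: npre.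
    have lt_tu1: size t < (size u).+1 by rewrite def_u1 size_cat ltnS leq_addr.
    exists (Ordinal lt_tu1) => /=.
    by rewrite def_u1 drop_size_cat.
  by rewrite lexlt_irr.
- apply/lyndonP; split=> // s t def_v s0 t0.
  have us0 : u ++ s <> [::] by case: (u) u0.
  have := min_v (u ++ s) t; rewrite -catA -def_v => /(_ def_w us0 t0)[def_t|//].
  move/(congr1 size): def_v; rewrite def_t size_cat.
  by case: (s) s0 => //= *; lia.
- by apply: lexlt_trans ltwv; rewrite def_w; apply: lexlt_prefix.
Qed.

(** If [u] is a letter, or the right standard factor of [u] is not smaller
    than [v], then [(u, v)] is the standard factorization of [u ++ v]. *)
Lemma std_cat u v : u <> [::] -> lyndon v ->
  (1 < size u -> ~~ lexlt (stdr u) v) -> stdl (u ++ v) = u /\ stdr (u ++ v) = v.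
Proof.
move=> u0 Lv le_v; have v0 := lyndon_neq0 Lv.
have gt1 : 1 < size (u ++ v).
  rewrite size_cat; case: (u) (v) u0 v0 => [|? ?] [|? ?] //= _ _; lia.
have [def_uv l0 r0 min_r] := std_spec gt1.
suff def_v : stdr (u ++ v) = v.
  by split=> //; rewrite /stdl def_v size_cat addnK take_size_cat.
case: (min_r u v (erefl _) u0 v0) => [//|lt_rv].
set r := stdr (u ++ v) in def_uv r0 min_r lt_rv *.
set s := stdl (u ++ v) in def_uv l0.
have [le_us|lt_su] := leqP (size u) (size s).
  have [z def_s def_v] := cat_eq_cat def_uv le_us.
  have [z0|/eqP z1] := eqVneq z [::]; first by rewrite def_v z0.
  have /lyndonP[_ {}Lv] := Lv.
  by have := lexlt_trans lt_rv (Lv _ _ def_v z1 r0); rewrite lexlt_irr.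
have [z def_u def_r] := cat_eq_cat (esym def_uv) (ltnW lt_su).
have z0 : z <> [::].
  by move=> z0; move: lt_su; rewrite def_u z0 cats0 ltnn.
have u_gt1 : 1 < size u.
  by rewrite def_u size_cat; case: (s) (z) l0 z0 => [|? ?] [|? ?] //= *; lia.
have [_ _ _ min_ru] := std_spec u_gt1.
have {}le_v := le_v u_gt1.
have lt_vz : v = z \/ lexlt v z.
  have [->|ne] := eqVneq v (stdr u).
    by case: (min_ru _ _ def_u l0 z0) => [->|]; [left | right].
  have lt_vr : lexlt v (stdr u) by apply: lexltNge; rewrite // eq_sym.
  case: (min_ru _ _ def_u l0 z0) => [->|lt]; right => //.
  exact: lexlt_trans lt_vr lt.
suff /lexlt_trans/(_ lt_rv) : lexlt v r by rewrite lexlt_irr.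
rewrite def_r; case: lt_vz => [<-|]; last exact: lexlt_catr.
exact: lexlt_prefix.
Qed.

(** ** Powers and rotations *)

(** The [d]-th power of a word under concatenation. *)
Definition wpow l d := flatten (nseq d l).

Lemma wpowS l d : wpow l d.+1 = l ++ wpow l d. Proof. by []. Qed.

Lemma wpow1 l : wpow l 1 = l. Proof. exact: cats0. Qed.

Lemma size_wpow l d : size (wpow l d) = d * size l.
Proof. by elim: d => // d IH; rewrite wpowS size_cat IH. Qed.

Lemma wpowD l d e : wpow l (d + e) = wpow l d ++ wpow l e.
Proof. by rewrite /wpow nseqD flatten_cat. Qed.

Lemma wpowM l d e : wpow l (d * e) = wpow (wpow l d) e.
Proof. by elim: e => [|e IH]; rewrite ?muln0 // mulnS wpowD IH. Qed.

Lemma lexlt_wpow l m d : size l = size m -> 0 < d -> lexlt l m ->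
  lexlt (wpow l d) (wpow m d).
Proof.
by case: d => // d sz _ lt; rewrite !wpowS lexlt_cat_size // sz.
Qed.

Lemma wpow_inj l m d : size l = size m -> 0 < d -> wpow l d = wpow m d -> l = m.
Proof.
case: d => // d sz _ /eqP; rewrite !wpowS eqseq_cat // => /andP[/eqP-> _] //.
Qed.

Lemma cat_wpow s t d : s ++ wpow (t ++ s) d = wpow (s ++ t) d ++ s.
Proof.
by elim: d => [|d IH]; rewrite ?cats0 // !wpowS -!catA -IH.
Qed.

Lemma rot_wpow l d i : i <= size l -> rot i (wpow l d) = wpow (rot i l) d.
Proof.
move=> le_il; have {le_il} [s [t [-> ->]]] : exists s t, l = s ++ t /\ i = size s.
  by exists (take i l), (drop i l); rewrite cat_take_drop size_takel.
case: d => // d; rewrite !wpowS -catA !rot_size_cat.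
by rewrite -!catA cat_wpow.
Qed.

(** A word of length divisible by [e] that is fixed by the rotation by [e] is a
    power of its prefix of length [e]. *)
Lemma wpow_rot u e : 0 < e -> e %| size u -> rot e u = u ->
  u = wpow (take e u) (size u %/ e).
Proof.
move=> e0 /dvdnP[k sz_u]; rewrite sz_u mulnK // => rot_u.
have [k0|k_gt0] := posnP k; first by rewrite k0; apply: size0nil; rewrite sz_u k0.
have le_eu : e <= size u by rewrite sz_u leq_pmull.
set l := take e u; have sz_l : size l = e by rewrite size_takel.
have := rot_u; rewrite -{2}[u](cat_take_drop e) /rot -/l; set v := drop e u.
have: size v = k.-1 * e by rewrite size_drop sz_u -subn1 mulnBl mul1n.
rewrite -[u](cat_take_drop e) -/l -/v -(prednK k_gt0) wpowS /= {rot_u} => szv E.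
congr (_ ++ _); elim: {k sz_u k_gt0}(k.-1) v szv E => [|k IH] v szv E.
  by apply: size0nil; rewrite szv.
have le_lv : size l <= size v by rewrite szv sz_l leq_pmull.
have [z def_v1 def_v2] := cat_eq_cat (esym E) le_lv.
rewrite def_v1 wpowS; congr (_ ++ _); apply: IH.
  by apply/eqP; rewrite -(eqn_add2l e) -{1}sz_l -size_cat -def_v1 szv mulSn.
by rewrite -def_v1 -def_v2.
Qed.

(** A Lyndon word is smaller than each of its proper rotations; [rot_lyndon] is
    the converse. *)
Lemma lyndon_rot w i : lyndon w -> 0 < i < size w -> lexlt w (rot i w).
Proof.
move=> /lyndonP[w0 Lw] /andP[i0 iw].
have lt : lexlt w (drop i w).
  apply: (Lw (take i w)); first by rewrite cat_take_drop.
    by move/(congr1 size); rewrite size_take iw /=; lia.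
  by move/(congr1 size); rewrite size_drop /=; lia.
exact: lexlt_catr.
Qed.

Lemma rot_lyndon w : w <> [::] ->
  (forall i, 0 < i < size w -> lexlt w (rot i w)) -> lyndon w.
Proof.
move=> w0 rotw; apply/lyndonP; split=> // s t def_w s0 t0.
have szs : 0 < size s < size w.
  rewrite def_w size_cat; case: (s) (t) s0 t0 => [|? ?] [|? ?] //= _ _; lia.
have lt_w_ts : lexlt w (t ++ s).
  by have := rotw _ szs; rewrite {2}def_w rot_size_cat.
apply/negPn/negP=> nlt.
have ne : t != w.
  by apply/eqP=> E; have := congr1 size def_w; rewrite size_cat E; case/andP: szs; lia.
have lt_tw : lexlt t w by apply: lexltNge nlt; rewrite eq_sym.
have [/existsP[i /eqP def_w1]|npre] :=
    boolP [exists i : 'I_(size w).+1, w == t ++ drop i w]; last first.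
  have /(lexlt_trans lt_w_ts) : lexlt (t ++ s) w.
    rewrite -[w]cats0; apply: lexlt_cat => // z def_w1; case/existsP: npre.
    have lt_tw1: size t < (size w).+1 by rewrite def_w1 size_cat ltnS leq_addr.
    by exists (Ordinal lt_tw1); rewrite /= def_w1 drop_size_cat.
  by rewrite lexlt_irr.
move: {i}(drop i w) def_w1 => y def_w1.
have lt_ys : lexlt y s by move: lt_w_ts; rewrite {1}def_w1 lexlt_cat2l.
have sz_ys : size y = size s.
  by have := congr1 size def_w1; rewrite {1}def_w !size_cat addnC => /addnI.
have szt : 0 < size t < size w.
  by have := congr1 size def_w; rewrite size_cat; case/andP: szs; lia.
have := rotw _ szt; rewrite {2}def_w1 rot_size_cat def_w.
have /lexlt_trans H : lexlt (y ++ t) (s ++ t) by apply: lexlt_cat_size; rewrite // sz_ys.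
by move/H; rewrite lexlt_irr.
Qed.

Lemma wpow_lyndon_rot l d i : lyndon l -> 0 < d -> 0 < i < size l ->
  rot i (wpow l d) <> wpow l d.
Proof.
move=> Ll d0 ibnd; rewrite rot_wpow; last by case/andP: ibnd => _ /ltnW.
move/wpow_inj; rewrite size_rot => /(_ (erefl _) d0) E.
by have := lyndon_rot Ll ibnd; rewrite E lexlt_irr.
Qed.

(** A word is in at most one way a power of a Lyndon word. *)
Lemma wpow_lyndon_inj l m d e : lyndon l -> lyndon m -> 0 < d -> 0 < e ->
  wpow l d = wpow m e -> l = m /\ d = e.
Proof.
move=> Ll Lm d0 e0 E.
have l0 := lyndon_size Ll; have m0 := lyndon_size Lm.
have szE : size l = size m.
  case: (ltngtP (size l) (size m)) => // lt.
    have /(@wpow_lyndon_rot m e (size l) Lm e0)[] : 0 < size l < size m by rewrite l0.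
    by rewrite -E rot_wpow // rot_size.
  have /(@wpow_lyndon_rot l d (size m) Ll d0)[] : 0 < size m < size l by rewrite m0.
  by rewrite E rot_wpow // rot_size.
have := congr1 size E; rewrite !size_wpow szE => /eqP; rewrite eqn_pmul2r // => /eqP Ede.
by split=> //; apply: (@wpow_inj l m d); rewrite // E Ede.
Qed.

End LyndonWords.

(** * Words as rotations of powers of Lyndon words *)

Section Rotations.
Variable X : finType.
Implicit Types (u v w s t l m : seq X).
Local Open Scope nat_scope.

Lemma rot_rotP i j w : exists k, rot i (rot j w) = rot k w.
Proof.
have [le_sz|/ltnW lei] := leqP (size w) i; first by exists j; rewrite rot_oversize // size_rot.
have [le_sz|/ltnW lej] := leqP (size w) j; first by exists i; rewrite (@rot_oversize _ j).
by eexists; apply: rot_add_mod.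
Qed.

Lemma rot_eq_sym u v k h : rot k u = rot h v -> exists k', u = rot k' v.
Proof.
move=> Euv; have [k' Ek'] := rot_rotP (size u - k) h v; exists k'.
by rewrite -Ek' -Euv -{1}(rotK k u) /rotr size_rot.
Qed.

Lemma rot_wpow_mod l d i : lyndon l -> exists2 j, j < size l &
  rot i (wpow l d) = rot j (wpow l d).
Proof.
move=> Ll; have l0 := lyndon_size Ll.
have [le_sz|lti] := leqP (size (wpow l d)) i.
  by exists 0; rewrite // rot_oversize // rot0.
rewrite size_wpow in lti; exists (i %% size l); first exact: ltn_pmod.
have le_qd : i %/ size l <= d by rewrite -(leq_pmul2r l0) (leq_trans (leq_divM _ _)) // ltnW.
rewrite {1}(divn_eq i (size l)) addnC rotD; last first.
  by rewrite addnC -divn_eq size_wpow ltnW.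
congr (rot _ _); rewrite -(subnKC le_qd) wpowD -size_wpow rot_size_cat.
by rewrite -!wpowD addnC.
Qed.

(** A power of a Lyndon word is the smallest of its rotations. *)
Lemma wpow_rot_ge l d i : lyndon l -> 0 < d -> ~~ lexlt (rot i (wpow l d)) (wpow l d).
Proof.
move=> Ll d0; have [j ltj ->] := rot_wpow_mod d i Ll.
rewrite rot_wpow ?(ltnW ltj) //.
have [->|j0] := posnP j; first by rewrite rot0 lexlt_irr.
have lt : lexlt l (rot j l) by apply: lyndon_rot; rewrite // j0.
have := @lexlt_wpow _ _ _ d _ d0 lt; rewrite size_rot => /(_ erefl) lt_d.
by apply/negP=> /lexlt_trans/(_ lt_d); rewrite lexlt_irr.
Qed.

(** Two powers of Lyndon words that are rotations of each other are equal,
    as both are the smallest rotation. *)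
Lemma wpow_rot_eq l m d e i j : lyndon l -> lyndon m -> 0 < d -> 0 < e ->
  rot i (wpow l d) = rot j (wpow m e) -> l = m /\ d = e.
Proof.
move=> Ll Lm d0 e0 E.
apply: wpow_lyndon_inj => //.
have [k Ek] := rot_eq_sym E; have [k' Ek'] := rot_eq_sym (esym E).
have := wpow_rot_ge k Lm e0; have := wpow_rot_ge k' Ll d0.
rewrite -Ek -Ek'; case: (lexlt_total (wpow l d) (wpow m e)) => [//|->|->] //.
Qed.

Lemma lexlt_min (S : seq (seq X)) : S <> [::] ->
  exists2 m, m \in S & {in S, forall t, ~~ lexlt t m}.
Proof.
elim: S => // s [|s' S] IH _.
  by exists s; rewrite ?mem_head // => t; rewrite inE => /eqP->; rewrite lexlt_irr.
have [//|m Sm min_m] := IH; have [lt|ge] := boolP (lexlt s m).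
  exists s; rewrite ?mem_head // => t; rewrite inE => /predU1P[->|/min_m].
    by rewrite lexlt_irr.
  by apply: contra => /lexlt_trans; apply.
exists m; first by rewrite inE Sm orbT.
by move=> t; rewrite inE => /predU1P[->|/min_m].
Qed.

(** Every nonempty word is a rotation of a power of a Lyndon word: its smallest
    rotation is a power of its prefix of length the period. *)
Lemma rot_wpow_exists w : w <> [::] -> exists i l d,
  [/\ lyndon l, 0 < d & rot i w = wpow l d].
Proof.
move=> w0; pose S := [seq rot i w | i <- iota 0 (size w).+1].
have [|u Su min_u] := @lexlt_min S; first by rewrite /S /=.
have S_rot i : rot i w \in S.
  have [le_sz|/ltnW lei] := leqP (size w) i.
    rewrite rot_oversize //; apply/mapP; exists 0; rewrite ?rot0 //.
  by apply/mapP; exists i; rewrite // mem_iota.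
have [i def_u] : exists i, u = rot i w by have /mapP[i _ ->] := Su; exists i.
have {}min_u j : ~~ lexlt (rot j u) u.
  apply: min_u; rewrite def_u; have [k ->] := rot_rotP j i w; exact: S_rot.
have szu : 0 < size u by rewrite def_u size_rot; case: (w) w0.
have exe : exists e, (0 < e) && (rot e u == u).
  by exists (size u); rewrite szu rot_size eqxx.
case: (ex_minnP exe) => e /andP[e0 /eqP rot_e] min_e.
have le_e : e <= size u by apply: min_e; rewrite szu rot_size eqxx.
have rot_qe q : q * e <= size u -> rot (q * e) u = u.
  elim: q => [|q IH]; first by rewrite rot0.
  rewrite mulSn => le_qe; rewrite rotD // IH //.
  by apply: leq_trans le_qe; rewrite leq_addl.
have dvd_e : e %| size u.
  rewrite /dvdn -leqn0 leqNgt; apply/negP=> m0.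
  have /min_e : (0 < size u %% e) && (rot (size u %% e) u == u).
    rewrite m0 /= -{2}(rot_qe (size u %/ e)) ?leq_divM // -rotD.
      by rewrite addnC -divn_eq rot_size eqxx.
    by rewrite addnC -divn_eq.
  by rewrite leqNgt ltn_pmod.
have def_pow := wpow_rot e0 dvd_e rot_e.
set l := take e u in def_pow; have szl : size l = e by rewrite size_takel.
have d0 : 0 < size u %/ e by rewrite divn_gt0.
exists i, l, (size u %/ e); split; rewrite -?def_u //.
apply: rot_lyndon => [l0|j]; first by rewrite -szl l0 in e0.
rewrite szl => /andP[j0 ltj].
have rot_j : rot j u = wpow (rot j l) (size u %/ e).
  by rewrite {1}def_pow rot_wpow // szl ltnW.
case: (lexlt_total l (rot j l)) => [El|//|lt].
  have /min_e : (0 < j) && (rot j u == u) by rewrite j0 rot_j -El -def_pow /=.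
  by rewrite leqNgt ltj.
case/negP: (min_u j); rewrite rot_j [X in lexlt _ X]def_pow.
by apply: lexlt_wpow; rewrite ?size_rot.
Qed.

(** The word [u] is the [d]-th power of a Lyndon word. *)
Definition lyndon_power d u : bool :=
  let l := take (size u %/ d) u in lyndon l && (u == wpow l d).

Lemma lyndon_power_wpow l d : lyndon l -> 0 < d -> lyndon_power d (wpow l d).
Proof.
move=> Ll d0; rewrite /lyndon_power size_wpow mulKn //.
have -> : take (size l) (wpow l d) = l.
  by rewrite -(prednK d0) wpowS take_size_cat.
by rewrite Ll eqxx.
Qed.

Lemma lyndon_powerP d u : lyndon_power d u ->
  exists l, [/\ lyndon l, u = wpow l d & size l = size u %/ d].
Proof.
move=> /andP[Ll /eqP Eu]; exists (take (size u %/ d) u); split=> //.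
by apply: size_takel; apply: leq_div.
Qed.

Lemma lyndon_power_gt0 d u : 0 < size u -> lyndon_power d u -> 0 < d.
Proof. by move=> u0 /lyndon_powerP[l [_ Eu _]]; rewrite Eu in u0; case: d u0 Eu. Qed.

Lemma lyndon_power_inj d e u : 0 < size u -> lyndon_power d u -> lyndon_power e u ->
  d = e.
Proof.
move=> u0 Pd Pe; have d0 := lyndon_power_gt0 u0 Pd; have e0 := lyndon_power_gt0 u0 Pe.
have [l [Ll El _]] := lyndon_powerP Pd; have [m [Lm Em _]] := lyndon_powerP Pe.
by case: (wpow_lyndon_inj Ll Lm d0 e0); rewrite -?El -?Em.
Qed.

(** The word [u] is the power [l^(p^k)] of a Lyndon word [l], for some [k]. *)
Definition ppow_lyndon p u : bool :=
  has (fun k => lyndon_power (p ^ k) u) (iota 0 (size u).+1).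

(** Counting words by rotations, for a rotation-invariant set [A] of words:
    a [d]-th power of a Lyndon word has [n / d] distinct rotations. *)
Lemma card_rotations n (A : pred (seq X)) : 0 < n ->
  (forall i u, A (rot i u) = A u) ->
  #|[set w : n.-tuple X | A w]|
  = \sum_(d < n.+1 | 0 < d) n %/ d * #|[set u : n.-tuple X | lyndon_power d u && A u]|.
Proof.
move=> n0 rotA; pose P (d : 'I_n.+1) := [set u : n.-tuple X | lyndon_power d u && A u].
pose rots (d : 'I_n.+1) := [set w : n.-tuple X | [exists ui : n.-tuple X * 'I_(n %/ d),
  (ui.1 \in P d) && (rot ui.2 ui.1 == w)]].
have tup0 (u : n.-tuple X) : 0 < size u by rewrite size_tuple.
have card_rots (d : 'I_n.+1) : 0 < d -> #|rots d| = n %/ d * #|P d|.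
  move=> d0; pose f (ui : n.-tuple X * 'I_(n %/ d)) := [tuple of rot ui.2 ui.1].
  have -> : rots d = f @: setX (P d) setT.
    apply/setP=> w; rewrite inE; apply/existsP/imsetP.
      case=> [[u i]] /= /andP[Pu /eqP Ew]; exists (u, i); first by rewrite in_setX Pu in_setT.
      by apply: val_inj; rewrite /= Ew.
    by case=> [[u i]]; rewrite in_setX in_setT andbT /= => Pu ->; exists (u, i); rewrite eqxx andbT.
  rewrite card_in_imset ?cardsX ?cardsT ?card_ord 1?mulnC // => -[u i] [v j].
  rewrite !in_setX !inE !andbT => /andP[Pu _] /andP[Pv _] /(congr1 val) /= E.
  have [l [Ll Eu szl]] := lyndon_powerP Pu; have [m [Lm Ev szm]] := lyndon_powerP Pv.
  rewrite size_tuple in szl; rewrite size_tuple in szm.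
  have [Elm _] : l = m /\ d = d :> nat.
    by apply: (@wpow_rot_eq l m d d i j) => //; rewrite -Eu -Ev.
  have Euv : u = v by apply: val_inj; rewrite /= Eu Ev Elm.
  rewrite -Euv in E *; congr (_, _); apply: val_inj => /=.
  wlog le_ij : i j E / i <= j.
    by move=> H; case: (leqP i j) => [/H->|/ltnW/H->].
  apply/eqP; rewrite eqn_leq le_ij /= leqNgt; apply/negP=> lt_ij.
  have ltj : j < size l by rewrite szl.
  case: (@wpow_lyndon_rot _ l d (j - i) Ll d0); first by rewrite subn_gt0 lt_ij; lia.
  rewrite -Eu; apply: (@rot_inj i); rewrite -rotD ?subnKC //.
  by rewrite size_tuple (leq_trans (ltnW (ltn_ord j))) // leq_div.
have one (w : n.-tuple X) : A w -> \sum_(d < n.+1 | 0 < d) (w \in rots d : nat) = 1.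
  move=> Aw; have [|i [l [d [Ll d0 Ew]]]] := @rot_wpow_exists w.
    by move=> w0; have := tup0 w; rewrite w0.
  have szn : n = d * size l by rewrite -size_wpow -Ew size_rot size_tuple.
  have ltd : d < n.+1 by rewrite ltnS szn leq_pmulr // lyndon_size.
  rewrite (bigD1 (Ordinal ltd)) //= big1 ?addn0 => [|e /andP[e0 ne]].
    rewrite inE; suff -> : [exists ui : n.-tuple X * 'I_(n %/ d),
        (ui.1 \in P (Ordinal ltd)) && (rot ui.2 ui.1 == w)] by [].
    have szu : size (wpow l d) == n by rewrite size_wpow -szn.
    have Ew' : rot i w = rot 0 (wpow l d) by rewrite rot0.
    have [k Ek] := rot_eq_sym Ew'; have [j ltj Ej] := rot_wpow_mod d k Ll.
    have ltjn : j < n %/ Ordinal ltd by rewrite /= szn mulKn.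
    apply/existsP; exists (Tuple szu, Ordinal ltjn).
    by rewrite inE /= lyndon_power_wpow // Ek Ej eqxx -Ew rotA Aw.
  apply/eqP; rewrite eqb0 inE; apply: contra ne => /existsP[[u j]] /= /andP[].
  rewrite inE => /andP[Pu _] /eqP Ej; have [m [Lm Eu _]] := lyndon_powerP Pu.
  apply/eqP/val_inj => /=; rewrite Eu in Ej.
  have [k Ek] := rot_rotP i j (wpow m e); rewrite Ej Ew in Ek.
  case: (@wpow_rot_eq l m d e 0 k Ll Lm d0 e0) => //.
  by rewrite rot0.
have -> : #|[set w : n.-tuple X | A w]| = \sum_(w : n.-tuple X | A w) 1.
  by rewrite sum1_card; apply: eq_card => w; rewrite !inE.
under [RHS]eq_bigr => d d0 do rewrite -card_rots //.
under [LHS]eq_bigr => w Aw do rewrite -(one w Aw).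
rewrite exchange_big; apply: eq_bigr => d d0.
rewrite -sum1_card big_mkcond [RHS]big_mkcond; apply: eq_bigr => w _.
case: ifP => [_|nA]; first by case: (w \in _).
case: ifP => //; rewrite inE => /existsP[[u i]] /= /andP[]; rewrite inE => /andP[_ Au] /eqP Ew.
by rewrite -Ew rotA Au in nA.
Qed.

End Rotations.

(** * The arithmetic function mu_p *)

Section MobiusSum.

(** The divisors of [q^k c], for a prime [q] not dividing [c]. *)
Lemma divisors_primeX q k c : prime q -> ~~ (q %| c)%N -> (0 < c)%N ->
  perm_eq (divisors (q ^ k * c))
          [seq (q ^ j * d)%N | j <- iota 0 k.+1, d <- divisors c].
Proof.
move=> q_pr nqc c0; have q0 := prime_gt0 q_pr; have qk0 j : (0 < q ^ j)%N by rewrite expn_gt0 q0.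
have n0 : (0 < q ^ k * c)%N by rewrite muln_gt0 qk0.
have logd d : (d %| c)%N -> logn q d = 0%N.
  move=> dc; apply/eqP; rewrite lognE q_pr (dvdn_gt0 c0 dc) /=.
  by case: ifP => // qd; rewrite (dvdn_trans qd dc) in nqc.
have logqd j d : (d %| c)%N -> logn q (q ^ j * d) = j.
  move=> dc; rewrite lognM ?qk0 ?(dvdn_gt0 c0 dc) // pfactorK // logd //.
  by rewrite addn0.
apply: uniq_perm; first exact: divisors_uniq.
  apply: allpairs_uniq; rewrite ?iota_uniq ?divisors_uniq // => x y.
  move=> /allpairsP[[j' d'] [_ d'c ->]] /allpairsP[[i' e'] [_ e'c ->]].
  rewrite /= in d'c e'c *; move=> E.
  rewrite -dvdn_divisors // in d'c; rewrite -dvdn_divisors // in e'c.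
  have Eij : j' = i' by rewrite -(logqd j' d') // E logqd.
  rewrite Eij in E *; congr (_, _); apply/eqP.
  by rewrite -(eqn_pmul2l (qk0 i')) E.
move=> m; rewrite -dvdn_divisors //; apply/idP/idP => [dvdm|].
  have m0 := dvdn_gt0 n0 dvdm.
  have [d co_qd def_m] := pfactor_coprime q_pr m0.
  apply/allpairsP; exists (logn q m, d); split; last by rewrite /= mulnC.
    rewrite mem_iota /= add0n ltnS -[X in (_ <= X)%N](logqd k c) //.
    exact: dvdn_leq_log.
  rewrite -dvdn_divisors //= -(@Gauss_dvdr _ (q ^ k)); last first.
    by rewrite coprime_sym coprimeXl.
  by apply: dvdn_trans dvdm; rewrite [X in (_ %| X)%N]def_m dvdn_mulr.
case/allpairsP=> [[j d] [jk dc ->]]; rewrite mem_iota /= add0n ltnS in jk.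
rewrite /= in dc *.
by rewrite dvdn_mul ?dvdn_exp2l // dvdn_divisors.
Qed.

Lemma mobius_primeX q j d : prime q -> ~~ (q %| d)%N -> (0 < d)%N ->
  mobius (q ^ j * d) = mobius d * (if j == 0%N then 1 else if j == 1%N then -1 else 0).
Proof.
move=> q_pr nqd d0; have [->|j0] := eqVneq j 0%N; first by rewrite expn0 mul1n mulr1.
have jgt0 : (0 < j)%N by rewrite lt0n.
have qj0 : (0 < q ^ j)%N by rewrite expn_gt0 prime_gt0.
have perm_pr : perm_eq (primes (q ^ j * d)) (q :: primes d).
  apply: uniq_perm; rewrite ?primes_uniq //=.
    by rewrite primes_uniq mem_primes q_pr d0 nqd.
  by move=> l; rewrite primesM // primesX // primes_prime // !inE.
have logq : logn q (q ^ j * d) = j.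
  by rewrite lognM // pfactorK // lognE q_pr d0 (negPf nqd) addn0.
have logl l : l \in primes d -> logn l (q ^ j * d) = logn l d.
  rewrite mem_primes => /and3P[l_pr _ ld]; rewrite lognM // lognX logn_prime //.
  case: eqP => [El|_]; last by rewrite muln0.
  by rewrite -El ld in nqd.
rewrite /mobius muln_gt0 qj0 d0 (perm_all _ perm_pr) (perm_size perm_pr) /= logq.
rewrite (eq_in_all (a2 := fun l => logn l d == 1%N)) => [|l /logl->//].
case: (j == 1%N) => /=; last by rewrite mulr0.
by case: all; rewrite ?mul0r // exprS mulrC.
Qed.

Lemma sum_mobius c : (0 < c)%N -> \sum_(d <- divisors c) mobius d = (c == 1%N)%:R.
Proof.
move=> c0; have [->|c1] := eqVneq c 1%N; first by rewrite big_seq1.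
have c_gt1 : (1 < c)%N by case: (c) c0 c1 => [|[]].
have q_pr := pdiv_prime c_gt1; set q := pdiv c in q_pr.
have [d co_qd def_c] := pfactor_coprime q_pr c0.
have nqd : ~~ (q %| d)%N by rewrite -prime_coprime.
have d0 : (0 < d)%N by move: c0; rewrite def_c muln_gt0 => /andP[].
have: (0 < logn q c)%N by rewrite logn_gt0 mem_primes q_pr c0 pdiv_dvd.
move: (logn q c) def_c => [|k] // -> _; rewrite mulnC.
rewrite (perm_big _ (divisors_primeX _ q_pr nqd d0)) big_allpairs_dep /=.
have step j : \sum_(e <- divisors d) mobius (q ^ j * e)
    = (\sum_(e <- divisors d) mobius e) *
      (if j == 0%N then 1 else if j == 1%N then -1 else 0).
  rewrite big_distrl [LHS]big_seq [RHS]big_seq; apply: eq_bigr => e.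
  rewrite -dvdn_divisors // => ed; rewrite mobius_primeX ?(dvdn_gt0 d0 ed) //.
  by apply: contra nqd => /dvdn_trans; apply.
under eq_bigr => j _ do rewrite step.
rewrite -big_distrr big_cons big_cons /= [X in _ + (_ + X)]big1_seq.
  by rewrite addr0 subrr mulr0.
move=> j; rewrite mem_iota => /andP[_ /andP[j2 _]].
by case: j j2 => [|[]].
Qed.

Lemma mobius_p_primeX p j d : prime p -> ~~ (p %| d)%N -> (0 < d)%N ->
  mobius_p p (p ^ j * d)
  = mobius d * (if j is j'.+1 then (p ^ j)%:Z - (p ^ j')%:Z else 1).
Proof.
move=> p_pr npd d0; rewrite /mobius_p.
case: j => [|j]; first by rewrite expn0 mul1n (negPf npd) mulr1.
have pj0 : (0 < p ^ j.+1)%N by rewrite expn_gt0 prime_gt0.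
have logp : logn p (p ^ j.+1 * d) = j.+1.
  by rewrite lognM // pfactorK // lognE p_pr d0 (negPf npd) addn0.
by rewrite expnS -mulnA dvdn_mulr // mulnA -expnS logp mulKn.
Qed.

(** Only the powers of [p] contribute: for [e = p^k c] with [p] not dividing
    [c], the sum is [1 + (p - 1) + ... + (p^k - p^(k-1)) = p^k] times the sum of
    [mobius] over the divisors of [c]. *)
Lemma sum_mobius_p p e : prime p -> (0 < e)%N ->
  \sum_(m <- divisors e) mobius_p p m = if e == (p ^ logn p e)%N then e%:Z else 0.
Proof.
move=> p_pr e0; have [c co_pc def_e] := pfactor_coprime p_pr e0.
have npc : ~~ (p %| c)%N by rewrite -prime_coprime.
have c0 : (0 < c)%N by move: e0; rewrite def_e muln_gt0 => /andP[].
move: def_e; set k := logn p e => ->; rewrite [(c * _)%N]mulnC.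
have pk0 : (0 < p ^ k)%N by rewrite expn_gt0 prime_gt0.
rewrite (perm_big _ (divisors_primeX _ p_pr npc c0)) big_allpairs_dep /=.
pose w j : int := if j is j'.+1 then (p ^ j)%:Z - (p ^ j')%:Z else 1.
have step j : \sum_(d <- divisors c) mobius_p p (p ^ j * d)
    = (\sum_(d <- divisors c) mobius d) * w j.
  rewrite big_distrl [LHS]big_seq [RHS]big_seq; apply: eq_bigr => d.
  rewrite -dvdn_divisors // => dc; rewrite mobius_p_primeX ?(dvdn_gt0 c0 dc) //.
  by apply: contra npc => /dvdn_trans; apply.
under eq_bigr => j _ do rewrite step.
have -> : (p ^ k * c == p ^ k)%N = (c == 1%N).
  by rewrite -[X in _ == X]muln1 eqn_pmul2l.
rewrite -big_distrr sum_mobius //=.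
case: eqP => [->|_]; last by rewrite mul0r.
rewrite mul1r muln1 -/(iota 0 k.+1) -/(index_iota 0 k.+1).
elim: (k) => [|j IH]; first by rewrite big_nat1.
by rewrite big_nat_recr // IH /= addrC subrK.
Qed.

End MobiusSum.

(** * Counting words of a given content *)

Section Content.
Variables (X : finType) (r : nat) (col : X -> 'I_r).
Implicit Types (u v w l : seq X) (a b : 'X_{1..r}).

(** The content of a word: the number of its letters of each color. *)
Definition cont u : 'X_{1..r} := [multinom count (fun x => col x == i) u | i < r].

Lemma contE u i : cont u i = count (fun x => col x == i) u.
Proof. by rewrite mnmE. Qed.

Lemma cont_cat u v : cont (u ++ v) = (cont u + cont v)%MM.
Proof. by apply/mnmP=> i; rewrite mnmDE !contE count_cat. Qed.

Lemma cont_perm u v : perm_eq u v -> cont u = cont v.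
Proof. by move=> /seq.permP uv; apply/mnmP=> i; rewrite !contE uv. Qed.

Lemma cont_cons x u : cont (x :: u) = (U_(col x) + cont u)%MM.
Proof. by apply/mnmP=> i; rewrite mnmDE !contE mnm1E. Qed.

Lemma cont_nil : cont [::] = 0%MM.
Proof. by apply/mnmP=> i; rewrite contE. Qed.

Lemma cont_wpow u d : cont (wpow u d) = (cont u *+ d)%MM.
Proof.
apply/mnmP=> i; rewrite mulmnE !contE.
by elim: d => [|d IH]; rewrite ?muln0 // wpowS count_cat IH mulnS.
Qed.

Lemma mdeg_cont u : mdeg (cont u) = size u.
Proof.
elim: u => [|x u IH]; first by rewrite cont_nil mdeg0.
by rewrite cont_cons mdegD mdeg1 IH.
Qed.

(** Divisibility of all exponents of [a] by [d]. *)
Definition mdvd d a := [forall i, d %| a i]%N.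
(** The exponentwise quotient of [a] by [d]; it is meaningful if [mdvd d a]. *)
Definition mdiv a d : 'X_{1..r} := [multinom (a i %/ d)%N | i < r].

Lemma mdivE a d i : mdiv a d i = (a i %/ d)%N. Proof. by rewrite mnmE. Qed.

Lemma mdivK a d : mdvd d a -> (mdiv a d *+ d)%MM = a.
Proof.
by move=> /forallP da; apply/mnmP=> i; rewrite mulmnE mdivE divnK.
Qed.

Lemma mdvd_muln a d : mdvd d (a *+ d)%MM.
Proof. by apply/forallP=> i; rewrite mulmnE dvdn_mull. Qed.

Lemma muln_mdiv a d : (0 < d)%N -> mdiv (a *+ d)%MM d = a.
Proof. by move=> d0; apply/mnmP=> i; rewrite mdivE mulmnE mulnK. Qed.

Lemma mdeg_mdiv a d : (0 < d)%N -> mdvd d a -> mdeg (mdiv a d) = (mdeg a %/ d)%N.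
Proof. by move=> d0 /mdivK{2}<-; rewrite mdegMn mulnK. Qed.

Lemma mdvd_mdeg a d : mdvd d a -> (d %| mdeg a)%N.
Proof. by move=> /mdivK<-; rewrite mdegMn dvdn_mull. Qed.

Lemma mdvd_leq a d : a != 0%MM -> mdvd d a -> (d <= mdeg a)%N.
Proof.
by move=> a0 /mdvd_mdeg; apply: dvdn_leq; rewrite lt0n mdeg_eq0.
Qed.

Lemma mdiv_mdiv a d e : mdiv (mdiv a d) e = mdiv a (d * e).
Proof. by apply/mnmP=> i; rewrite !mdivE divnMA. Qed.

Lemma mdvdM a d e : (0 < d)%N -> mdvd (d * e) a = mdvd d a && mdvd e (mdiv a d).
Proof.
move=> d0; apply/forallP/andP=> [dea|[/forallP da /forallP ea] i].
  have da i : (d %| a i)%N by apply: dvdn_trans (dea i); rewrite dvdn_mulr.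
  by split; apply/forallP=> i; rewrite ?mdivE ?dvdn_divRL // mulnC.
by have := ea i; rewrite mdivE dvdn_divRL // mulnC.
Qed.

Lemma mdiv_neq0 a d : (0 < d)%N -> a != 0%MM -> mdvd d a -> mdiv a d != 0%MM.
Proof.
move=> d0 a0 da; rewrite -mdeg_eq0 mdeg_mdiv // -lt0n divn_gt0 //.
exact: mdvd_leq.
Qed.

(** The numbers of words and of Lyndon words of content [a]. *)
Definition num_words a := #|[set u : (mdeg a).-tuple X | cont u == a]|.
Definition num_lyndon a := #|[set u : (mdeg a).-tuple X | lyndon u && (cont u == a)]|.

(** The map [l |-> l^d] is a bijection from the Lyndon words of content [a / d]
    to the [d]-th powers of Lyndon words of content [a]. *)
Lemma card_lyndon_power n d a : mdeg a = n -> (0 < d)%N ->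
  #|[set u : n.-tuple X | lyndon_power d u && (cont u == a)]|
  = if mdvd d a then num_lyndon (mdiv a d) else 0%N.
Proof.
move=> def_n d0; case: ifP => [da|nda]; last first.
  apply: eq_card0 => u; rewrite inE; apply/negbTE/negP=> /andP[/lyndon_powerP[l [_ Eu _]]].
  by move/eqP=> def_a; rewrite -def_a Eu cont_wpow mdvd_muln in nda.
have sz (l : (mdeg (mdiv a d)).-tuple X) : size (wpow l d) == n.
  by rewrite size_wpow size_tuple mdeg_mdiv // mulnC divnK ?mdvd_mdeg ?def_n.
pose f (l : (mdeg (mdiv a d)).-tuple X) : n.-tuple X := Tuple (sz l).
rewrite /num_lyndon -[RHS](card_in_imset (f := f)); last first.
  move=> l m _ _ /(congr1 val) /= E; apply: val_inj; apply: wpow_inj d0 E.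
  by rewrite !size_tuple.
apply: eq_card => u; rewrite inE; apply/andP/imsetP.
  case=> [/lyndon_powerP[l [Ll Eu szl]] /eqP Ea].
  have def_l : size l == mdeg (mdiv a d) by rewrite szl size_tuple mdeg_mdiv ?def_n.
  exists (Tuple def_l); last by apply: val_inj; rewrite /= Eu.
  by rewrite inE /= Ll -Ea Eu cont_wpow muln_mdiv // eqxx.
case=> l; rewrite inE => /andP[Ll /eqP El] -> /=.
by rewrite lyndon_power_wpow // cont_wpow El mdivK.
Qed.

(** Every word is a rotation of a power of a Lyndon word. The bound [K] on the
    index is free because the divisors of [a] are at most [mdeg a]. *)
Lemma num_words_lyndon a K : a != 0%MM -> (mdeg a <= K)%N ->
  num_words a = (\sum_(d < K.+1 | (0 < d) && mdvd d a)
                  mdeg a %/ d * num_lyndon (mdiv a d))%N.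
Proof.
move=> a0 leK; have n0 : (0 < mdeg a)%N by rewrite lt0n mdeg_eq0.
have rotA i u : (cont (rot i u) == a) = (cont u == a).
  by rewrite (@cont_perm _ u) // perm_rot.
rewrite /num_words (card_rotations n0 rotA).
rewrite (eq_bigr (fun d : 'I__ => if mdvd d a then
    mdeg a %/ d * num_lyndon (mdiv a d) else 0)%N); last first.
  by move=> d d0; rewrite card_lyndon_power //; case: ifP; rewrite ?muln0.
rewrite -big_mkcondr.
rewrite [LHS](big_ord_widen_cond K.+1 (fun d => (0 < d) && mdvd d a)%N
  (fun d => mdeg a %/ d * num_lyndon (mdiv a d))%N) //.
apply: eq_bigl => d; rewrite -andbA; congr (_ && _).
by rewrite ltnS; apply: andb_idr; apply: mdvd_leq.
Qed.

(** ** Mobius inversion *)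

Section Inversion.
Variable p : nat.
Hypothesis p_pr : prime p.

Let pX_gt0 k : (0 < p ^ k)%N. Proof. by rewrite expn_gt0 prime_gt0. Qed.

(** The number of words of content [a] that are [p^k]-th powers of Lyndon words
    for some [k]. *)
Definition num_ppow_lyndon a := 
  #|[set u : (mdeg a).-tuple X | ppow_lyndon p u && (cont u == a)]|.

Lemma num_ppow_lyndonE a : a != 0%MM ->
  num_ppow_lyndon a
  = (\sum_(k < (mdeg a).+1 | mdvd (p ^ k) a) num_lyndon (mdiv a (p ^ k)))%N.
Proof.
move=> a0; have n0 : (0 < mdeg a)%N by rewrite lt0n mdeg_eq0.
rewrite big_mkcond /=.
under eq_bigr => k _ do rewrite -(card_lyndon_power (erefl (mdeg a)) (pX_gt0 k)).
rewrite /num_ppow_lyndon -sum1_card.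
under [RHS]eq_bigr => k _ do rewrite -sum1_card big_mkcond.
rewrite exchange_big big_mkcond; apply: eq_bigr => u _; rewrite inE.
rewrite /ppow_lyndon size_tuple; have [/hasP[k kn Pk]|/hasPn none] := boolP (has _ _); last first.
  rewrite big1 // => k _; rewrite inE (negbTE (none k _)) //.
  by rewrite mem_iota /= add0n.
rewrite mem_iota /= add0n in kn.
rewrite (bigD1 (Ordinal kn)) //= inE Pk big1 ?addn0 // => j ne.
rewrite inE; case: ifP => // /andP[Pj _]; case/eqP: ne; apply: val_inj => /=.
have u0 : (0 < size u)%N by rewrite size_tuple.
have /eqP := lyndon_power_inj u0 Pj Pk.
by rewrite eqn_exp2l ?prime_gt1 // => /eqP.
Qed.

(** Substituting [num_words_lyndon] on the right-hand side leaves the sums of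
    [mobius_p] over the divisors of a number [e], which vanish unless [e] is a
    power of [p]. *)
Lemma num_ppow_lyndon_inversion a : a != 0%MM ->
  (mdeg a * num_ppow_lyndon a)%N%:Z
  = \sum_(m < (mdeg a).+1 | (0 < m)%N && mdvd m a)
      mobius_p p m * (num_words (mdiv a m))%:Z.
Proof.
move=> a0; set n := mdeg a; have n0 : (0 < n)%N by rewrite lt0n mdeg_eq0.
pose H e : int := (n %/ e * num_lyndon (mdiv a e))%N%:Z.
have expand (m : 'I_n.+1) : (0 < m)%N && mdvd m a ->
    mobius_p p m * (num_words (mdiv a m))%:Z
    = \sum_(d < n.+1 | (0 < d)%N && mdvd d (mdiv a m)) mobius_p p m * H (m * d)%N.
  case/andP=> m0 ma; rewrite (@num_words_lyndon _ n) ?mdiv_neq0 //; last first.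
    by rewrite mdeg_mdiv // leq_div.
  rewrite -natz natr_sum big_distrr /=; apply: eq_bigr => d _; congr (_ * _).
  by rewrite natz /H mdeg_mdiv // mdiv_mdiv divnMA.
rewrite (eq_bigr _ expand) pair_big_dep /=.
pose prod_md (md : 'I_n.+1 * 'I_n.+1) : 'I_n.+1 := inord (md.1 * md.2).
(* Sort the pairs [(m, d)] by their product [e]. *)
rewrite (partition_big prod_md (fun e : 'I_n.+1 => (0 < e)%N && mdvd e a)) /=; last first.
  case=> m d /= /andP[/andP[m0 ma] /andP[d0 da]].
  have mda : mdvd (m * d) a by rewrite mdvdM // ma da.
  by rewrite inordK ?muln_gt0 ?m0 ?d0 // ltnS; apply: mdvd_leq.
have inner (e : 'I_n.+1) : (0 < e)%N && mdvd e a ->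
    \sum_(md : 'I_n.+1 * 'I_n.+1 | [&& (0 < md.1)%N && mdvd md.1 a,
        (0 < md.2)%N && mdvd md.2 (mdiv a md.1) & prod_md md == e])
      mobius_p p md.1 * H (md.1 * md.2)%N
    = if (e == p ^ logn p e :> nat)%N then e%:Z * H e else 0.
  case/andP=> e0 ea; have le_en : (e <= n)%N by rewrite -ltnS.
  have prodE (m d : 'I_n.+1) : (0 < m)%N && mdvd m a -> (0 < d)%N && mdvd d (mdiv a m) ->
      prod_md (m, d) == e -> (m * d)%N = e.
    move=> /andP[m0 ma] /andP[d0 da] /eqP <-.
    have mda : mdvd (m * d) a by rewrite mdvdM // ma da.
    by rewrite /prod_md inordK // ltnS; apply: mdvd_leq.
  have quo_lt (m : 'I_n.+1) : (e %/ m < n.+1)%N.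
    by rewrite (leq_ltn_trans (leq_div _ _)).
  rewrite (reindex_onto (fun m => (m, Ordinal (quo_lt m))) fst) /=; last first.
    case=> m d /= /and3P[Pm Pd Pmd]; congr (_, _); apply: val_inj => /=.
    by rewrite -(prodE m d) // mulKn //; case/andP: Pm.
  transitivity (\sum_(m < n.+1 | (m %| e)%N) mobius_p p m * H e).
    have quoE m := prodE m (Ordinal (quo_lt m)).
    apply: eq_big => [m|m /andP[/and3P[Pm Pd Pmd] _]]; last first.
      have E : (m * (e %/ m))%N = e := quoE m Pm Pd Pmd.
      by rewrite E.
    rewrite eqxx andbT; apply/and3P/idP => [[Pm Pd Pmd]|me].
      have E : (m * (e %/ m))%N = e := quoE m Pm Pd Pmd.
      by rewrite -E dvdn_mulr.
    have m0 := dvdn_gt0 e0 me; have Ee : (m * (e %/ m))%N = e by rewrite mulnC divnK.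
    have := ea; rewrite -{1}Ee mdvdM // => /andP[-> ->]; rewrite m0 divn_gt0 // dvdn_leq //.
    by split=> //; apply/eqP/val_inj; rewrite /prod_md /= Ee inordK.
  rewrite -big_distrl /=.
  have -> : \sum_(m < n.+1 | (m %| e)%N) mobius_p p m = \sum_(m <- divisors e) mobius_p p m.
    rewrite -(big_mkord (fun m => m %| e)%N) -big_filter; apply: perm_big.
    apply: uniq_perm; rewrite ?filter_uniq ?iota_uniq ?divisors_uniq // => m.
    rewrite mem_filter -dvdn_divisors // mem_index_iota /= andb_idr // ltnS => me.
    exact: leq_trans (dvdn_leq e0 me) le_en.
  by rewrite (sum_mobius_p p_pr e0); case: ifP; rewrite ?mul0r.
under [RHS]eq_bigr => e Pe.
  under eq_bigl => md do rewrite -andbA.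
  rewrite (inner e Pe).
  over.
rewrite -big_mkcondr /= num_ppow_lyndonE // -/n.
rewrite (eq_bigr (fun e : 'I_n.+1 => (n * num_lyndon (mdiv a e))%N%:Z)); last first.
  move=> e /andP[/andP[_ /mdvd_mdeg e_n] _].
  by rewrite /H -PoszM mulnA [(e * _)%N]mulnC divnK.
rewrite [RHS](reindex_onto (fun k : 'I_n.+1 => inord (p ^ k) : 'I_n.+1)
  (fun e => inord (logn p e))) /=; last first.
  move=> e /andP[_ /eqP e_pow]; apply: val_inj; rewrite /= [in (_ ^ _)%N]inordK.
    by rewrite -e_pow inordK.
  rewrite ltnS; apply: leq_trans (_ : e <= n)%N; last by rewrite -ltnS.
  by rewrite [X in (_ <= X)%N]e_pow; apply/ltnW/ltn_expl/(prime_gt1 p_pr).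
have bound (k : 'I_n.+1) : mdvd (p ^ k) a -> (p ^ k < n.+1)%N.
  by rewrite ltnS; apply: mdvd_leq.
rewrite big_distrr /= -natz natr_sum; apply: eq_big => [k|k dk]; last first.
  by rewrite natz inordK ?bound.
apply/idP/idP => [dk|].
  by rewrite !inordK ?bound // pX_gt0 dk pfactorK // eqxx /=; apply/eqP/val_inj; rewrite /= inordK.
case/andP=> /andP[/andP[e0 ea] _] _; move: e0 ea.
have [lt|ge] := ltnP (p ^ k) n.+1; first by rewrite inordK.
by rewrite /inord /insubd insubF //= ltnNge ge.
Qed.

End Inversion.
End Content.

(** * Multinomial coefficients and logarithms *)

Section Multinomials.
Variables (X : finType) (r : nat) (col : X -> 'I_r).
Variable s : 'I_r -> nat.
Hypothesis s_card : forall i, #|[set x | col x == i]| = s i.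
Implicit Types (u v w : seq X) (a b : 'X_{1..r}).

Lemma big_tuple_cons (R : nmodType) n (f : seq X -> R) :
  \sum_(w : n.+1.-tuple X) f w = \sum_x \sum_(w : n.-tuple X) f (x :: w).
Proof.
rewrite pair_big /=.
rewrite (reindex (fun xw : X * n.-tuple X => cons_tuple xw.1 xw.2)) //=.
exists (fun w : n.+1.-tuple X => (thead w, behead_tuple w)) => [[x w] _|w _].
  by congr (_, _); apply: val_inj.
by apply: val_inj; rewrite /= [in RHS](tuple_eta w).
Qed.

Lemma sum_col (R : pzSemiRingType) (f : 'I_r -> R) :
  \sum_x f (col x) = \sum_i (s i)%:R * f i.
Proof.
rewrite (partition_big col xpredT) //=; apply: eq_bigr => i _.
rewrite (eq_bigr (fun _ => f i)) => [|x /eqP-> //].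
rewrite sumr_const mulr_natl -s_card; congr (_ *+ _).
by apply: eq_card => x; rewrite !inE.
Qed.

(** The multinomial coefficient of [a] times the product of the [s i ^ a i]. *)
Definition multinomial a : rat :=
  (mdeg a)`!%:R / (\prod_(i < r) ((a i)`!)%:R) * \prod_(i < r) (s i)%:R ^+ a i.

(** The term of index [i] equals [multinomial a * (a i / (n + 1))], and the
    [a i] add up to [n + 1]. *)
Lemma multinomial_rec n a : mdeg a = n.+1 ->
  multinomial a = \sum_(i < r) (s i)%:R * (if (0 < a i)%N then multinomial (a - U_(i))%MM else 0).
Proof.
move=> def_n.
have nz c : (\prod_(i < r) ((c i)`!)%:R : rat) != 0.
  by apply/prodf_neq0 => i _; rewrite pnatr_eq0 -lt0n fact_gt0.
have step i : (s i)%:R * (if (0 < a i)%N then multinomial (a - U_(i))%MM else 0)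
    = multinomial a * ((a i)%:R / n.+1%:R).
  case: ifP => [ai_gt0|/negbT]; last first.
    by rewrite -eqn0Ngt => /eqP->; rewrite mul0r !mulr0.
  set b := (a - U_(i))%MM; have def_a : a = (U_(i) + b)%MM.
    by rewrite addmC submK // lep1mP -lt0n.
  have deg_b : mdeg b = n.
    by have := def_n; rewrite def_a mdegD mdeg1 => -[].
  have ai : a i = (b i).+1 by rewrite def_a mnmDE mnm1E eqxx.
  have aj j : j != i -> a j = b j.
    by move=> ne; rewrite def_a mnmDE mnm1E eq_sym (negPf ne).
  rewrite /multinomial def_n deg_b factS natrM.
  have -> : \prod_(j < r) ((a j)`!)%:R = (a i)%:R * \prod_(j < r) ((b j)`!)%:R :> rat.
    rewrite (bigD1 i) //= [in RHS](bigD1 i) //= ai factS natrM -mulrA.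
    by congr (_ * (_ * _)); apply: eq_bigr => j ne; rewrite aj.
  have -> : \prod_(j < r) (s j)%:R ^+ a j = (s i)%:R * \prod_(j < r) (s j)%:R ^+ b j :> rat.
    rewrite (bigD1 i) //= [in RHS](bigD1 i) //= ai exprS -mulrA.
    by congr (_ * (_ * _)); apply: eq_bigr => j ne; rewrite aj.
  have ai0 : (a i)%:R != 0 :> rat by rewrite pnatr_eq0 -lt0n.
  have n0 : n.+1%:R != 0 :> rat by rewrite pnatr_eq0.
  have := nz b; move: (\prod_(j < r) _) (\prod_(j < r) _) => B S B0.
  move: (a i)%:R n.+1%:R n`!%:R (s i)%:R ai0 n0 => A M N S' A0 M0.
  by field; rewrite A0 M0 B0.
under eq_bigr => i _ do rewrite step.
rewrite -big_distrr -big_distrl /= -natr_sum -mdegE def_n mulfV ?mulr1 //.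
by rewrite pnatr_eq0.
Qed.

Lemma num_words_multinomial a : (num_words col a)%:R = multinomial a.
Proof.
rewrite /num_words -sum1_card big_mkcond natr_sum.
have [n def_n] : exists n, mdeg a = n by exists (mdeg a).
rewrite def_n.
transitivity (\sum_(u : n.-tuple X) (cont col u == a)%:R : rat).
  by apply: eq_bigr => u _; rewrite inE; case: eqP.
elim: n a def_n => [|n IH] a def_n.
  have -> : a = 0%MM by apply/eqP; rewrite -mdeg_eq0 def_n.
  rewrite (big_pred1 [tuple]) => [|u]; last by apply/esym/eqP/tuple0.
  rewrite cont_nil eqxx /multinomial mdeg0 fact0.
  rewrite !big1 ?divr1 ?mulr1 // => i _; first by rewrite mnm0E.
  by rewrite mnm0E.
rewrite (big_tuple_cons _ (fun u => (cont col u == a)%:R)) (multinomial_rec def_n).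
rewrite -(sum_col (fun i => if (0 < a i)%N then multinomial (a - U_(i))%MM else 0)).
apply: eq_bigr => x _; set i := col x.
have [ai_gt0|ai0] := ltnP 0 (a i); last first.
  rewrite big1 // => w _; rewrite cont_cons; case: eqP => // E.
  by move: ai0; rewrite -E mnmDE mnm1E eqxx.
have def_a : a = (U_(i) + (a - U_(i)))%MM by rewrite addmC submK // lep1mP -lt0n.
rewrite -IH; last by have := def_n; rewrite {1}def_a mdegD mdeg1 => -[].
apply: eq_bigr => w _; rewrite cont_cons {1}def_a; congr (nat_of_bool _)%:R.
by apply/eqP/eqP => [/addmI|->].
Qed.

(** The polynomial [s_1 t_1^m + ... + s_r t_r^m]. *)
Let upoly m : {mpoly rat[r]} := \sum_(i < r) (s i)%:R *: 'X_i ^+ m.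

(** Expanding the power of [\sum_x t_(col x)^m] yields one monomial for each
    word of length [k], namely [t^(m * content)]. *)
Lemma coef_upoly_expr m k b : (0 < m)%N ->
  (upoly m ^+ k)@_b
  = if mdvd m b && (k == mdeg (mdiv b m)) then multinomial (mdiv b m) else 0.
Proof.
move=> m0.
have -> : upoly m ^+ k = \sum_(w : k.-tuple X) 'X_[(cont col w *+ m)%MM].
  elim: k => [|k IH].
    rewrite (big_pred1 [tuple]) => [|u]; last by apply/esym/eqP/tuple0.
    rewrite expr0 cont_nil (_ : (0 *+ m)%MM = 0%MM) ?mpolyX0 //.
    by apply/mnmP=> i; rewrite mulmnE !mnm0E mul0n.
  rewrite (big_tuple_cons _ (fun w => 'X_[(cont col w *+ m)%MM])) exprS IH.
  rewrite [X in X * _](_ : _ = \sum_x 'X_(col x) ^+ m); last first.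
    rewrite (sum_col (fun i => 'X_i ^+ m : {mpoly rat[r]})).
    by apply: eq_bigr => i _; rewrite mulr_natl scaler_nat.
  rewrite big_distrl; apply: eq_bigr => x _ /=; rewrite big_distrr.
  apply: eq_bigr => w _ /=; rewrite cont_cons mpolyXn -mpolyXD.
  by congr 'X_[_]; apply/mnmP=> i; rewrite !(mulmnE, mnmDE) mulnDl.
rewrite raddf_sum /=.
under eq_bigr => w _ do rewrite mcoeffX.
case: ifP => [/andP[mb /eqP def_k]|nmb]; last first.
  rewrite big1 // => w _; case: eqP => // E; case/negP: nmb.
  by rewrite -E mdvd_muln muln_mdiv // mdeg_cont size_tuple eqxx.
rewrite -num_words_multinomial /num_words -sum1_card -def_k.
rewrite [RHS]natr_sum [RHS]big_mkcond; apply: eq_bigr => w _; rewrite inE -{1}(mdivK mb).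
have -> : (cont col w *+ m == mdiv b m *+ m)%MM = (cont col w == mdiv b m).
  apply/eqP/eqP => [/mnmP E|-> //]; apply/mnmP=> i; have := E i.
  by rewrite !mulmnE => /eqP; rewrite eqn_pmul2r // => /eqP.
by case: eqP.
Qed.

(** The logarithm of [1 - upoly m] has the coefficient
    [- multinomial (a / m) / (|a| / m)] at [t^a] if [m] divides [a], else 0. *)
Lemma log1m_upoly m a : (0 < m)%N -> a != 0%MM ->
  log1m (upoly m) a
  = if mdvd m a then - (multinomial (mdiv a m) * (m%:R / (mdeg a)%:R)) else 0.
Proof.
move=> m0 a0; rewrite /log1m; set n := mdeg a.
under eq_bigr => k _ do rewrite coef_upoly_expr //.
case: ifP => [ma|nma] /=; last first.
  by rewrite big1 ?oppr0 // => k _; rewrite mul0r.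
have k_le : (mdeg (mdiv a m) < n.+1)%N by rewrite ltnS mdeg_mdiv // leq_div.
have k_gt0 : (0 < mdeg (mdiv a m))%N by rewrite lt0n mdeg_eq0 mdiv_neq0.
have k_in : mdeg (mdiv a m) \in index_iota 1 n.+1 by rewrite mem_index_iota k_gt0.
rewrite (bigD1_seq _ k_in (iota_uniq _ _)) /= eqxx big1 ?addr0 => [|k /negPf->]; last by rewrite mul0r.
have def_n : n = (mdeg (mdiv a m) * m)%N by rewrite mdeg_mdiv // divnK ?mdvd_mdeg.
congr (- (_ * _)); rewrite def_n natrM invfM mulrCA mulfV ?mulr1 //.
by rewrite pnatr_eq0 -lt0n.
Qed.

End Multinomials.

(** * Twisted commutators and Jacobson's formula *)

Section TwistedCommutator.
Variables (R : nzRingType) (tau : R -> R) (a : R).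
Hypothesis tauB : {morph tau : b c / b - c}.
Hypothesis tauM : {morph tau : b c / b * c}.
Hypothesis taua : tau a = a.

(** The iterates of [b |-> a b - tau(b) a], for an endomorphism [tau] fixing
    [a], expand as a binomial: left multiplication by [a] commutes with
    [b |-> tau(b) a]. *)
Lemma iter_twisted k b :
  iter k (fun c => a * c - tau c * a) b
  = \sum_(j < k.+1) ((-1) ^+ j *+ 'C(k, j)) * (a ^+ (k - j) * iter j tau b * a ^+ j).
Proof.
have itB j : {morph iter j tau : c d / c - d}.
  by elim: j => // j IH c d; rewrite /= IH tauB.
have ita j c : iter j tau (a * c) = a * iter j tau c.
  by elim: j => //= j ->; rewrite tauM taua.
have itar j c : iter j tau (c * a) = iter j tau c * a.
  by elim: j => //= j ->; rewrite tauM taua.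
elim: k b => [|k IH] b.
  by rewrite big_ord1 /= bin0 !expr0 mulr1n !mul1r mulr1.
rewrite iterSr IH.
under eq_bigr => j _ do rewrite itB mulrBr mulrBl mulrBr.
rewrite big_split /= sumrN [RHS]big_ord_recl /=.
rewrite [X in X - _]big_ord_recl ita /=.
rewrite !bin0 !subn0 !expr0 !mulr1n !mul1r !mulr1 mulrA -exprSr -addrA; congr (_ + _).
rewrite [in RHS](eq_bigr (fun j : 'I_k.+1 =>
    ((-1) ^+ j.+1 *+ 'C(k, j.+1)) * (a ^+ (k - j) * iter j.+1 tau b * a ^+ j.+1)
    - ((-1) ^+ j *+ 'C(k, j)) * (a ^+ (k - j) * iter j.+1 tau b * a ^+ j.+1))); last first.
  move=> j _; rewrite /bump /= add1n subSS binS mulrnDr mulrDl; congr (_ + _).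
  by rewrite -mulNr; congr (_ * _); rewrite exprS mulN1r mulNrn.
rewrite big_split /= sumrN; congr (_ + _); last first.
  congr (- _); apply: eq_bigr => j _; congr (_ * _).
  by rewrite itar -iterSr /= exprS !mulrA.
rewrite [RHS]big_ord_recr /= bin_small // mulr0n mul0r addr0.
apply: eq_bigr => j _; rewrite /bump /= add1n; congr (_ * _).
rewrite -[j.+1]/(j.+1) -iterS ita !mulrA -exprSr; congr (_ ^+ _ * _ * _).
by rewrite subnSK.
Qed.

Variable p : nat.
Hypothesis charR : p \in [pchar R].

Lemma signr_bin_pchar j : (j < p)%N -> (-1) ^+ j *+ 'C(p.-1, j) = 1 :> R.
Proof.
have p_pr := pcharf_prime charR; have p_gt0 := prime_gt0 p_pr.
elim: j => [|j IH] ltjp; first by rewrite bin0.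
have bin0 : (-1) ^+ j.+1 *+ 'C(p, j.+1) = 0 :> R.
  have /dvdnP[m ->] := prime_dvd_bin p_pr (ltjp : 0 < j.+1 < p)%N.
  by rewrite mulrnA -mulr_natr pcharf0 // mulr0.
rewrite -[RHS](IH (ltnW ltjp)) -[RHS]addr0 -[X in _ + X]bin0 -[in 'C(p, _)](prednK p_gt0) binS.
by rewrite mulrnDr exprS mulN1r !mulNrn addrCA subrr addr0.
Qed.

Lemma iter_twisted_pchar b :
  iter p (fun c => a * c - tau c * a) b = a ^+ p * b - iter p tau b * a ^+ p.
Proof.
have p_pr := pcharf_prime charR; have p_gt0 := prime_gt0 p_pr.
rewrite iter_twisted big_ord_recl -[in \sum_(i < _) _](prednK p_gt0).
rewrite big_ord_recr /= big1 ?add0r => [|j _].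
  rewrite bin0 subn0 expr0 mulr1n mul1r mulr1 prednK // /bump /= add1n.
  rewrite prednK // subnn binn mulr1n expr0 mul1r.
  have := pFrobenius_autN charR 1; rewrite !pFrobenius_autE expr1n => ->.
  by rewrite mulN1r add0n -iterS prednK.
rewrite -[bump 0 j]/(j.+1) (prednK p_gt0).
have ltjp : (0 < j.+1 < p)%N by rewrite /= -[X in (_ < X)%N](prednK p_gt0) ltnS.
have /dvdnP[m ->] := prime_dvd_bin p_pr ltjp.
by rewrite mulrnA -mulr_natr pcharf0 // mulr0 mul0r.
Qed.

End TwistedCommutator.

Section Jacobson.
Variables (F : fieldType) (R : algType F) (p : nat).
Hypothesis charF : p \in [pchar F].
Implicit Types x y : R.

Let p_pr : prime p. Proof. exact: pcharf_prime charF. Qed.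
Let p_gt0 : (0 < p)%N. Proof. exact: prime_gt0. Qed.

Lemma pchar_alg : p \in [pchar R].
Proof. by rewrite (pchar_lalg R). Qed.

Lemma pchar_polyR : p \in [pchar {poly R}].
Proof. by rewrite pchar_poly pchar_alg. Qed.

(** In characteristic [p] the signed binomial coefficients of order [p - 1]
    are all equal to 1. *)
Lemma iter_ring_comm_predp (S : nzRingType) (charS : p \in [pchar S]) (a b : S) :
  iter p.-1 (fun c => a * c - c * a) b
  = \sum_(j < p) a ^+ (p.-1 - j) * b * a ^+ j.
Proof.
rewrite (@iter_twisted S id) // prednK //; apply: eq_bigr => j _.
rewrite signr_bin_pchar // mul1r; congr (_ * _ * _).
by elim: (nat_of_ord j) => //= i ->.
Qed.

Lemma deriv_expr_noncomm (S : nzRingType) (q : {poly S}) n :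
  (q ^+ n)^`() = \sum_(j < n) q ^+ (n.-1 - j) * q^`() * q ^+ j.
Proof.
elim: n => [|n IH]; first by rewrite expr0 big_ord0 -polyC1 derivC.
rewrite exprSr derivM IH big_ord_recl /= subn0 expr0 mulr1 [RHS]addrC.
congr (_ + _); rewrite big_distrl; apply: eq_bigr => j _ /=.
rewrite -mulrA -exprSr; congr (_ ^+ _ * _ * _).
by rewrite /bump /= add1n subnS -predn_sub.
Qed.

(** The commutator of an associative algebra. *)
Definition ring_comm (a b : R) : R := a * b - b * a.

(** [ad_coef] computes the coefficients of the iterated commutators with
    [tx + y], the variable [t] being central. *)
Lemma coef_iter_ring_comm x y (z : R) k j :
  let q := x%:P * 'X + y%:P in
  (iter k (fun c => q * c - c * q) z%:P)`_j = ad_coef ring_comm x y z k j.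
Proof.
move=> q; elim: k j => [|k IH] j; first by rewrite /= coefC.
rewrite iterS; set c := iter _ _ _ in IH *; rewrite [ad_coef _ _ _ _ _ _]/=.
rewrite /ring_comm -!IH coefB /q mulrDl mulrDr -mulrA -commr_polyX !mulrA.
rewrite !coefD coefCM coefMC !coefMX.
case: j => [|j] /=; first by rewrite !add0r.
by rewrite -!IH coefCM coefMC opprD addrACA.
Qed.

Lemma coef_linear_expr x y n :
  let q := x%:P * 'X + y%:P in
  [/\ (q ^+ n)`_0 = y ^+ n, (q ^+ n)`_n = x ^+ n
    & forall m, (n < m)%N -> (q ^+ n)`_m = 0].
Proof.
move=> q; elim: n => [|n [IH0 IHn IHm]].
  by rewrite !expr0; split=> [||m]; rewrite coef1 //; case: m.
have coefS m : (q ^+ n.+1)`_m.+1 = x * (q ^+ n)`_m + y * (q ^+ n)`_m.+1.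
  by rewrite exprS {1}/q mulrDl -mulrA -commr_polyX mulrA coefD coefMX !coefCM.
split.
- by rewrite !exprS {1}/q mulrDl -mulrA -commr_polyX mulrA coefD coefMX !coefCM IH0 /= add0r.
- by rewrite (coefS n) IHn IHm // mulr0 addr0 exprS.
- by case=> // m lt_nm; rewrite coefS !IHm ?mulr0 ?addr0 // ltnW.
Qed.

(** Jacobson's formula for the p-th power of a sum. The derivative of
    [(tx + y)^p] is [(ad (tx + y))^(p-1) (x)], so that [i s_i(x, y)] is [i]
    times the coefficient of [t^i] in [(tx + y)^p]. *)
Lemma jacobson_formula x y :
  (x + y) ^+ p = x ^+ p + y ^+ p + \sum_(1 <= i < p) jacobson_s p ring_comm i x y.
Proof.
set q := x%:P * 'X + y%:P.
have [c0 cp cm] := coef_linear_expr x y p.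
have q1 : q.[1] = x + y by rewrite !hornerE.
have qp1 : (x + y) ^+ p = (q ^+ p).[1].
  by rewrite horner_exp_comm ?q1 // /comm_poly mul1r mulr1.
have szq : (size (q ^+ p) <= p.+1)%N by apply/leq_sizeP=> j; exact: cm.
rewrite qp1 (horner_coef_wide 1 szq).
under eq_bigr => i _ do rewrite expr1n mulr1.
rewrite -(big_mkord xpredT (fun i => (q ^+ p)`_i)) big_nat_recr //= cp.
rewrite big_ltn // c0 [LHS]addrC addrA; congr (_ + _).
rewrite !big_nat; apply: eq_bigr => i /andP[i_gt0 ltip].
rewrite /jacobson_s -coef_iter_ring_comm -/q.
rewrite (iter_ring_comm_predp pchar_polyR).
have q' : q^`() = x%:P by rewrite /q derivMXaddC derivC mul0r addr0.
rewrite -q' -deriv_expr_noncomm coef_deriv prednK // -scaler_nat scalerA.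
rewrite mulVf ?scale1r //.
rewrite -(dvdn_pcharf charF); apply/negP=> /(dvdn_leq i_gt0).
by rewrite leqNgt ltip.
Qed.

End Jacobson.

(** * Graded matrix algebras as color Lie p-algebras *)

Section GradedMatrices.
Variables (F : fieldType) (p : nat) (G : finGroupType) (gamma : G -> G -> F).
Hypothesis charF : p \in [pchar F].
Hypothesis abelG : abelian [set: G].
Hypothesis gamma_skew : skew_bicharacter gamma.
Hypothesis gamma_plus : forall h : G, gamma h h = 1.
Variables (n : nat) (d : 'I_n.+1 -> G).
Implicit Types (g h k : G) (A B C : 'M[F]_n.+1).

Let gammaM g h k : gamma (g * h)%g k = gamma g k * gamma h k.
Proof. by case: gamma_skew. Qed.
Let gammaMr g h k : gamma g (h * k)%g = gamma g h * gamma g k.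
Proof. by case: gamma_skew. Qed.
Let gammaK g h : gamma g h * gamma h g = 1.
Proof. by case: gamma_skew. Qed.
Let mulGC g h : (g * h = h * g)%g.
Proof. by apply: (centsP abelG); rewrite inE. Qed.

(** When the basis vector of index [i] has degree [d i], a matrix is
    homogeneous of degree [h] if it raises degrees by [h]. *)
Definition mxhom h A : Prop := forall i j, A i j != 0 -> d i = (h * d j)%g.

(** The automorphism of the graded matrix algebra that multiplies each
    homogeneous matrix of degree [h] by [gamma g h]. *)
Definition twist g A : 'M[F]_n.+1 :=
  \matrix_(i, j) (gamma g (d i * (d j)^-1)%g * A i j).

(** The color commutator: [A B - gamma(g, h) B A] for [A] and [B] homogeneous of
    degrees [g] and [h], extended bilinearly. *)
Definition colorbr A B : 'M[F]_n.+1 :=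
  A * B - \matrix_(i, k)
    \sum_j gamma (d j * (d k)^-1)%g (d i * (d j)^-1)%g * (B i j * A j k).

Lemma colorbr_hom h A B : mxhom h A -> colorbr A B = A * B - twist h B * A.
Proof.
move=> homA; congr (_ - _); apply/matrixP=> i k; rewrite !mxE.
apply: eq_bigr => j _; rewrite !mxE mulrA.
have [->|nz] := eqVneq (A j k) 0; first by rewrite !mulr0.
by rewrite (homA _ _ nz) mulgK.
Qed.

Lemma twist_hom g h B : mxhom h B -> twist g B = gamma g h *: B.
Proof.
move=> homB; apply/matrixP=> i j; rewrite !mxE.
have [->|nz] := eqVneq (B i j) 0; first by rewrite !mulr0.
by rewrite (homB _ _ nz) mulgK.
Qed.

Lemma twistB g : {morph twist g : A B / A - B}.
Proof. by move=> A B; apply/matrixP=> i j; rewrite !mxE mulrBr. Qed.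

Lemma twistM g : {morph twist g : A B / A * B}.
Proof.
move=> A B; apply/matrixP=> i k; rewrite !mxE big_distrr; apply: eq_bigr => j _ /=.
rewrite !mxE mulrACA -gammaMr; congr (gamma _ _ * _).
by rewrite mulgA mulgKV.
Qed.

Lemma twist_comp g h A : twist g (twist h A) = twist (g * h)%g A.
Proof. by apply/matrixP=> i j; rewrite !mxE mulrA -gammaM. Qed.

Let gamma1 h : gamma 1%g h = 1.
Proof.
have nz: gamma 1%g h != 0 by case: gamma_skew.
by apply: (mulfI nz); rewrite -gammaM mulg1 mulr1.
Qed.

Lemma twist1 A : twist 1%g A = A.
Proof. by apply/matrixP=> i j; rewrite !mxE gamma1 mul1r. Qed.

Lemma iter_twist g m A : iter m (twist g) A = twist (g ^+ m)%g A.
Proof.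
elim: m => [|m IH]; first by rewrite expg0 twist1.
by rewrite iterS IH twist_comp expgS.
Qed.

Lemma mxhom_sub h : is_subspace (mxhom h).
Proof.
split=> [i j|a A B homA homB i j]; rewrite !mxE ?eqxx //.
have [A0|nz _] := eqVneq (A i j) 0; last exact: homA.
by rewrite A0 mulr0 add0r; apply: homB.
Qed.

Lemma mxhom0 h : mxhom h 0. Proof. by case: (mxhom_sub h). Qed.

Lemma mxhomZ h a A : mxhom h A -> mxhom h (a *: A).
Proof.
move=> homA; rewrite -[_ *: _]addr0.
by apply: (mxhom_sub h).2 => //; apply: mxhom0.
Qed.

Lemma mxhomD h A B : mxhom h A -> mxhom h B -> mxhom h (A + B).
Proof. by move=> homA; rewrite -[A]scale1r; apply: (mxhom_sub h).2. Qed.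

Lemma mxhomB h A B : mxhom h A -> mxhom h B -> mxhom h (A - B).
Proof.
by move=> homA homB; rewrite -scaleN1r; apply: mxhomD => //; apply: mxhomZ.
Qed.

Lemma mxhomM g h A B : mxhom g A -> mxhom h B -> mxhom (g * h)%g (A * B).
Proof.
move=> homA homB i k; rewrite mxE => nz.
have [j] : exists j, A i j * B j k != 0.
  apply/existsP; apply: contraNT nz => /existsPn all0.
  by rewrite big1 // => j _; apply/eqP/negPn/all0.
by rewrite mulf_eq0 negb_or => /andP[/homA-> /homB->]; rewrite mulgA.
Qed.

Lemma mxhom1 : mxhom 1%g 1.
Proof.
by move=> i j; rewrite !mxE mul1g; case: (i =P j) => [->|_] //=; rewrite eqxx.
Qed.

Lemma mxhomX g A m : mxhom g A -> mxhom (g ^+ m)%g (A ^+ m).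
Proof.
move=> homA; elim: m => [|m IH]; first by rewrite expg0 expr0; apply: mxhom1.
by rewrite expgS exprS; apply: mxhomM.
Qed.

Lemma mxhom_direct : direct_sum mxhom.
Proof.
split=> [A|u homu sum0 h].
  exists (fun h => \matrix_(i, j) if d i == (h * d j)%g then A i j else 0).
    by move=> h i j; rewrite !mxE; case: (d i =P (h * d j)%g) => //= _; rewrite eqxx.
  apply/matrixP=> i j; rewrite summxE (bigD1 (d i * (d j)^-1)%g) //= mxE mulgKV.
  rewrite eqxx big1 ?addr0 // => h ne; rewrite mxE; case: eqP => // E.
  by rewrite E mulgK eqxx in ne.
apply/matrixP=> i j; rewrite mxE; apply/eqP/negPn/negP=> nz.
have def_i := homu h i j nz.
have /matrixP/(_ i j) := sum0; rewrite summxE (bigD1 h) //= big1 ?addr0.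
  by rewrite mxE => E; rewrite E eqxx in nz.
move=> k ne; apply/eqP/negPn/negP=> /homu; rewrite def_i => /mulIg E.
by rewrite E eqxx in ne.
Qed.

Lemma colorbr_linearl B : linear (colorbr ^~ B).
Proof.
move=> a A C; rewrite /colorbr mulrDl -scalerAl scalerBr addrACA -opprD.
congr (_ - _); apply/matrixP=> i k; rewrite !mxE big_distrr -big_split /=.
by apply: eq_bigr => j _; rewrite !mxE; ring.
Qed.

Lemma colorbr_linearr A : linear (colorbr A).
Proof.
move=> a B C; rewrite /colorbr mulrDr -scalerAr scalerBr addrACA -opprD.
congr (_ - _); apply/matrixP=> i k; rewrite !mxE big_distrr -big_split /=.
by apply: eq_bigr => j _; rewrite !mxE; ring.
Qed.

Lemma colorbr_hom2 g h A B : mxhom g A -> mxhom h B ->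
  colorbr A B = A * B - gamma g h *: (B * A).
Proof.
by move=> homA homB; rewrite (colorbr_hom _ homA) (twist_hom _ homB) scalerAl.
Qed.

Lemma colorbr_comp g h A B : mxhom g A -> mxhom h B ->
  mxhom (g * h)%g (colorbr A B).
Proof.
move=> homA homB; rewrite (colorbr_hom2 homA homB); apply: mxhomB.
  exact: mxhomM.
by apply: mxhomZ; rewrite mulGC; apply: mxhomM.
Qed.

Lemma colorbr_skew g h A B : mxhom g A -> mxhom h B ->
  colorbr A B = - (gamma g h *: colorbr B A).
Proof.
move=> homA homB; rewrite (colorbr_hom2 homA homB) (colorbr_hom2 homB homA).
by rewrite scalerBr scalerA gammaK scale1r opprB.
Qed.

Lemma colorbr_jacobi g h A B C : mxhom g A -> mxhom h B ->
  colorbr A (colorbr B C)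
  = colorbr (colorbr A B) C + gamma g h *: colorbr B (colorbr A C).
Proof.
move=> homA homB.
rewrite (colorbr_hom _ (colorbr_comp homA homB)) !(colorbr_hom _ homA) !(colorbr_hom _ homB).
rewrite !twistB !twistM (twist_hom g homB) (twist_hom h homA) !twist_comp [(h * g)%g]mulGC.
rewrite !(mulrBr, mulrBl, scalerBr) -!scalerAl -!scalerAr ?scalerBr !scalerA gammaK scale1r.

rewrite -!scalerAl scalerA gammaK scale1r !mulrA !opprB addrACA.
rewrite [RHS]addrACA !subrKA [RHS]addrACA; congr (_ + _); exact: addrC.
Qed.

Lemma colorbr_alt g A : mxhom g A -> colorbr A A = 0.
Proof.
by move=> homA; rewrite (colorbr_hom2 homA homA) gamma_plus scale1r subrr.
Qed.

Definition mx_colorLie : colorLie gamma :=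
  ColorLie mxhom_sub mxhom_direct colorbr_linearl colorbr_linearr
    colorbr_comp colorbr_skew colorbr_jacobi colorbr_alt.

Let charM : p \in [pchar 'M[F]_n.+1]. Proof. exact: pchar_alg charF. Qed.

(** The bracket with [A] is the twisted commutator for [twist g], which fixes
    [A] because [gamma g g = 1]. *)
Lemma colorbr_exp g A B : mxhom g A ->
  colorbr (A ^+ p) B = iter p (colorbr A) B.
Proof.
move=> homA; rewrite (colorbr_hom _ (@mxhomX g A p homA)) -iter_twist.
have twA : twist g A = A by rewrite (twist_hom _ homA) gamma_plus scale1r.
rewrite -(iter_twisted_pchar (twistB g) (twistM g) twA charM).
by apply: eq_iter => C; rewrite (colorbr_hom _ homA).
Qed.

Lemma gamma_expr g m : gamma g (g ^+ m)%g = 1.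
Proof.
elim: m => [|m IH]; last by rewrite expgS gammaMr gamma_plus IH mulr1.
by have := gammaK g 1%g; rewrite gamma1 mulr1.
Qed.

(** On homogeneous matrices whose degrees are powers of [g], the color
    commutator is the ordinary one. *)
Lemma ad_coef_colorbr g A B (k j : nat) : mxhom g A -> mxhom g B ->
  ad_coef colorbr A B A k j = ad_coef (@ring_comm F 'M[F]_n.+1) A B A k j
  /\ mxhom (g ^+ k.+1)%g (ad_coef colorbr A B A k j).
Proof.
move=> homA homB.
have brE m (C D : 'M_n.+1) : mxhom g C -> mxhom (g ^+ m)%g D ->
    colorbr C D = ring_comm C D.
  by move=> homC homD; rewrite (colorbr_hom2 homC homD) gamma_expr scale1r.
elim: k j => [|k IH] j /=.
  by case: eqP => _; split; rewrite ?expg1 //; apply: mxhom0.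
have [IHj homj] := IH j; rewrite expgS.
case: j IHj homj => [|j] IHj homj.
  rewrite -IHj -(brE _ _ _ homB homj) !add0r; split=> //.
  exact: colorbr_comp.
have [IHj' homj'] := IH j.
rewrite -IHj -IHj' -(brE _ _ _ homB homj) -(brE _ _ _ homA homj'); split=> //.
by apply: mxhomD; apply: colorbr_comp.
Qed.

Lemma exprD_colorbr g A B : mxhom g A -> mxhom g B ->
  (A + B) ^+ p = A ^+ p + B ^+ p
    + \sum_(1 <= i < p) jacobson_s p (@cl_br F G gamma mx_colorLie) i A B.
Proof.
move=> homA homB; rewrite (jacobson_formula charF); congr (_ + _).
apply: eq_bigr => i _; congr (_ *: _).
by case: (ad_coef_colorbr p.-1 i.-1 homA homB).
Qed.

(** The graded matrix algebra, with the color commutator and the p-th power,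
    is a color Lie p-algebra. *)
Definition mx_colorLieP : colorLieP p gamma :=
  @ColorLieP F p G gamma mx_colorLie (fun _ A => A ^+ p)
    (fun g A homA => @mxhomX g A p homA)
    (fun g a A _ => exprZn a A p)
    colorbr_exp exprD_colorbr.

End GradedMatrices.

(** * Linear spans *)

Section Span.
Variable F : fieldType.

(** The linear span of a subset of a vector space. *)
Inductive in_span (V : lmodType F) (Q : V -> Prop) : V -> Prop :=
| span_zero : in_span Q 0
| span_lin (c : F) u v : Q u -> in_span Q v -> in_span Q (c *: u + v).

Implicit Types U V W : lmodType F.

Lemma span_gen V (Q : V -> Prop) v : Q v -> in_span Q v.
Proof.
by move=> Qv; rewrite -[v]scale1r -[_ *: _]addr0; apply: span_lin; last constructor.
Qed.

Lemma spanD V (Q : V -> Prop) u v : in_span Q u -> in_span Q v -> in_span Q (u + v).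
Proof.
move=> Su Sv; elim: {u} Su => [|c u w Qu _ IH]; first by rewrite add0r.
by rewrite -addrA; apply: span_lin.
Qed.

Lemma spanZ V (Q : V -> Prop) c v : in_span Q v -> in_span Q (c *: v).
Proof.
elim=> [|a u w Qu _ IH]; first by rewrite scaler0; constructor.
by rewrite scalerDr scalerA; apply: span_lin.
Qed.

Lemma spanN V (Q : V -> Prop) v : in_span Q v -> in_span Q (- v).
Proof. by move=> Sv; rewrite -scaleN1r; apply: spanZ. Qed.

Lemma span_sum V (Q : V -> Prop) (I : Type) (r : seq I) (P : pred I) (f : I -> V) :
  (forall i, P i -> in_span Q (f i)) -> in_span Q (\sum_(i <- r | P i) f i).
Proof. by move=> Sf; apply: big_ind => //; [constructor | apply: spanD]. Qed.

Lemma span_bind V W (Q : V -> Prop) (Q' : W -> Prop) (f : V -> W) : linear f ->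
  (forall v, Q v -> in_span Q' (f v)) -> forall v, in_span Q v -> in_span Q' (f v).
Proof.
move=> lin_f Qf v; elim=> [|c u w Qu _ IH].
  have := lin_f (-1) 0 0; rewrite scaler0 addr0 scaleN1r addNr => ->.
  by constructor.
by rewrite lin_f; apply: spanD => //; apply: spanZ; apply: Qf.
Qed.

Lemma span_mono V (Q Q' : V -> Prop) : (forall v, Q v -> Q' v) ->
  forall v, in_span Q v -> in_span Q' v.
Proof.
move=> sQ; apply: (@span_bind _ _ _ _ id) => // v Qv.
by apply: span_gen; apply: sQ.
Qed.

Lemma span_bilinear U V W (Q1 : U -> Prop) (Q2 : V -> Prop) (Q : W -> Prop)
    (f : U -> V -> W) :
  (forall v, linear (f ^~ v)) -> (forall u, linear (f u)) ->
  (forall u v, Q1 u -> Q2 v -> in_span Q (f u v)) ->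
  forall u v, in_span Q1 u -> in_span Q2 v -> in_span Q (f u v).
Proof.
move=> linl linr Qf u v Su Sv.
apply: (span_bind (linl v)) Su => {}u Qu.
by apply: (span_bind (linr u)) Sv => {}v; apply: Qf.
Qed.

End Span.

(** * Spanning by powers of Lyndon elements *)

Section LyndonSpan.
Variables (F : fieldType) (p : nat) (G : finGroupType) (gamma : G -> G -> F).
Hypothesis charF : p \in [pchar F].
Hypothesis abelG : abelian [set: G].
Variables (X : finType) (deg : X -> G) (L : colorLieP p gamma) (iota : X -> L).
Hypothesis iota_deg : forall x, cl_comp (deg x) (iota x).
Implicit Types (u v w s t l : seq X).

Let p_gt0 : (0 < p)%N. Proof. exact/prime_gt0/(pcharf_prime charF). Qed.
Let mulGC (g h : G) : (g * h = h * g)%g.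
Proof. by apply: (centsP abelG); rewrite inE. Qed.

(** The product of the degrees of the letters of a word. *)
Definition degw w : G := (\prod_(x <- w) deg x)%g.

Lemma degw_cat u v : degw (u ++ v) = (degw u * degw v)%g.
Proof. exact: big_cat. Qed.

Lemma degw_perm u v : perm_eq u v -> degw u = degw v.
Proof.
move=> uv; apply: (@catCA_perm_ind _ (fun w => degw u = degw w) _ u v uv) => //.
by move=> s1 s2 s3 ->; rewrite !degw_cat !mulgA [(degw s1 * _)%g]mulGC.
Qed.

Lemma degw_wpow w m : degw (wpow w m) = (degw w ^+ m)%g.
Proof.
elim: m => [|m IH]; first by rewrite /degw big_nil expg0.
by rewrite wpowS degw_cat IH expgS.
Qed.

Notation br := (@cl_br F G gamma L).

Lemma comp0 h : cl_comp h (0 : L).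
Proof. by case: (cl_comp_sub L h). Qed.

Lemma compZ h c (x : L) : cl_comp h x -> cl_comp h (c *: x).
Proof.
by move=> hx; rewrite -[_ *: _]addr0; apply: (cl_comp_sub L h).2 => //; apply: comp0.
Qed.

Lemma compD h (x y : L) : cl_comp h x -> cl_comp h y -> cl_comp h (x + y).
Proof. by move=> hx hy; rewrite -[x]scale1r; apply: (cl_comp_sub L h).2. Qed.

Lemma comp_unique g h (x : L) : cl_comp g x -> cl_comp h x -> g != h -> x = 0.
Proof.
move=> gx hx ne; have [_ indep] := cl_comp_direct L.
pose u k : L := if k == g then x else if k == h then - x else 0.
have hu k : cl_comp k (u k).
  rewrite /u; case: eqP => [->//|_]; case: eqP => [->|_]; last exact: comp0.
  by rewrite -scaleN1r; apply: compZ.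
have := indep u hu _ g; rewrite {2}/u eqxx; apply.
rewrite (bigD1 g) //= (bigD1 h) /= 1?eq_sym // {1 2}/u !eqxx eq_sym (negPf ne).
rewrite big1 ?addr0 ?subrr // => k /andP[/negPf k1 /negPf k2].
by rewrite /u k1 k2.
Qed.

Lemma pmap0 h : clp_pmap h (0 : L) = 0.
Proof.
have := clp_pmapZ (0 : F) (comp0 h); rewrite !scale0r => ->.
by rewrite expr0n -[p == 0%N]/(p == 0%N) gtn_eqF // scale0r.
Qed.

(** The number [m] bounds the depth of the recursion; any [m >= size w] gives
    the same value, and the empty word is sent to 0. *)
Fixpoint lyndon_br_rec m w : L :=
  match m, w with
  | m'.+1, [:: x] => iota x
  | m'.+1, _ :: _ :: _ => br (lyndon_br_rec m' (stdl w)) (lyndon_br_rec m' (stdr w))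
  | _, _ => 0
  end.

(** The bracketing of a Lyndon word along its iterated standard
    factorizations. *)
Definition lyndon_br w := lyndon_br_rec (size w) w.

Lemma lyndon_br_recE m w : (size w <= m)%N -> lyndon_br_rec m w = lyndon_br w.
Proof.
rewrite /lyndon_br; move: (leqnn (size w)); move: {2}(size w) => k.
elim: k m w => [|k IH] [|m] [|x [|y w]] // le_wk le_wm.
have /andP[/andP[_ ltl] /andP[_ ltr]] := @std_size _ (x :: y :: w) isT.
rewrite -![size (x :: y :: w)]/(size w).+2 in ltl ltr le_wk le_wm *.
have le1 n' m' n'' : (m' < n' -> n' <= n''.+1 -> m' <= n'')%N.
  by move=> lt le; rewrite -ltnS (leq_trans lt).
pose z := x :: y :: w; rewrite -/z in ltl ltr *.
change (br (lyndon_br_rec m (stdl z)) (lyndon_br_rec m (stdr z))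
  = br (lyndon_br_rec (size w).+1 (stdl z)) (lyndon_br_rec (size w).+1 (stdr z))).
congr (br _ _); rewrite [LHS]IH ?[RHS]IH //;
  solve [exact: le1 ltl le_wk | exact: le1 ltr le_wk | exact: le1 ltl le_wm
        | exact: le1 ltr le_wm].
Qed.

Lemma lyndon_br1 x : lyndon_br [:: x] = iota x. Proof. by []. Qed.

Lemma lyndon_brE w : (1 < size w)%N ->
  lyndon_br w = br (lyndon_br (stdl w)) (lyndon_br (stdr w)).
Proof.
case: w => [|x [|y w]] // _.
have /andP[/andP[_ ltl] /andP[_ ltr]] := @std_size _ (x :: y :: w) isT.
set z := x :: y :: w in ltl ltr *.
change (br (lyndon_br_rec (size w).+1 (stdl z)) (lyndon_br_rec (size w).+1 (stdr z))
  = br (lyndon_br (stdl z)) (lyndon_br (stdr z))).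
by rewrite !lyndon_br_recE.
Qed.

(** Induction along standard factorizations. *)
Lemma std_ind (P : seq X -> Prop) :
  P [::] -> (forall x, P [:: x]) ->
  (forall w, (1 < size w)%N -> P (stdl w) -> P (stdr w) -> P w) ->
  forall w, P w.
Proof.
move=> P0 P1 Pstd w; have [k] := ubnP (size w).
elim: k w => // k IH [|x [|y w]] // ltk.
have /andP[/andP[_ ltl] /andP[_ ltr]] := @std_size _ (x :: y :: w) isT.
by apply: Pstd => //; apply: IH; [apply: leq_trans ltl ltk | apply: leq_trans ltr ltk].
Qed.

Lemma lyndon_br_comp w : cl_comp (degw w) (lyndon_br w).
Proof.
elim/std_ind: w => [|x|w gt1 IHl IHr]; first exact: comp0.
  by rewrite /degw big_seq1.
rewrite (lyndon_brE gt1); have [def_w _ _ _] := std_spec gt1.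
by rewrite [in degw w]def_w degw_cat; apply: cl_br_comp.
Qed.

(** The number of words of length at most [K] that are smaller than [v]. *)
Let rank K v := #|[set w : K.-bseq X | lexlt w v]|.

Let rank_lt K u v : (size u <= K)%N -> lexlt u v -> (rank K u < rank K v)%N.
Proof.
move=> le_uK lt_uv; apply/proper_card/properP; split.
  by apply/subsetP=> w; rewrite !inE => /lexlt_trans; apply.
by exists (Bseq le_uK); rewrite !inE //= lexlt_irr.
Qed.

(** The Lyndon elements of the rearrangements of [u ++ v] that are smaller than
    the larger of [u] and [v]. *)
Let lower u v (z : L) : Prop := exists t,
  [/\ lyndon t, perm_eq t (u ++ v), lexlt t u || lexlt t v & z = lyndon_br t].

Let br_skew u v : br (lyndon_br u) (lyndon_br v)
  = - (gamma (degw u) (degw v) *: br (lyndon_br v) (lyndon_br u)).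
Proof. exact: cl_br_skew (lyndon_br_comp u) (lyndon_br_comp v). Qed.

(** The bracket of two Lyndon elements is a combination of Lyndon elements
    smaller than the larger of the two. If [(u, v)] is a standard factorization,
    the bracket is itself a Lyndon element; otherwise [u] is the product of
    [u' < u'' < v] and the Jacobi identity reduces the claim to shorter words,
    then to smaller maxima. *)
Lemma br_lyndon_lower u v : lyndon u -> lyndon v ->
  in_span (lower u v) (br (lyndon_br u) (lyndon_br v)).
Proof.
have [N] := ubnP (size u + size v)%N; elim: N u v => // N IHN u v.
rewrite ltnS leq_eqVlt => /predU1P[|]; last by move=> lt; apply: IHN.
have [m lt_um] := ubnP (rank N u); have [m' lt_vm] := ubnP (rank N v).
have {lt_um} : (rank N u < maxn m m')%N by rewrite leq_max lt_um.
have {lt_vm} : (rank N v < maxn m m')%N by rewrite leq_max lt_vm orbT.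
elim: {m m'}(maxn m m') u v => // m IHm.
suff IHlt u v : (rank N v < m.+1)%N -> (size u + size v)%N = N -> lyndon u ->
    lyndon v -> lexlt u v -> in_span (lower u v) (br (lyndon_br u) (lyndon_br v)).
  move=> u v rk_v rk_u sz Lu Lv; case: (lexlt_total u v) => [->|lt|lt].
  - by rewrite (cl_br_alt (lyndon_br_comp v)); constructor.
  - exact: IHlt.
  rewrite br_skew; apply/spanN/spanZ.
  have := IHlt v u rk_u; rewrite addnC => /(_ sz Lv Lu lt).
  apply: span_mono => z [t [Lt pt ltt ->]]; exists t; split=> //.
    by rewrite (perm_trans pt) // perm_catC.
  by rewrite orbC.
move=> rk_v sz Lu Lv lt_uv; have u0 := lyndon_neq0 Lu; have v0 := lyndon_neq0 Lv.
have [/andP[u_gt1 lt_rv]|std_uv] := boolP ((1 < size u) && lexlt (stdr u) v)%N; last first.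
  have [|def_u def_v] := std_cat u0 Lv.
    by move=> gt1; rewrite gt1 in std_uv.
  rewrite -{2}def_u -{3}def_v -lyndon_brE; last first.
    by rewrite size_cat (leq_add (lyndon_size Lu) (lyndon_size Lv)).
  apply: span_gen; exists (u ++ v); split=> //; first exact: lyndon_cat.
  by rewrite lyndon_cat_ltr ?orbT.
have [Ll Lr lt_lr] := std_lyndon Lu u_gt1.
have [def_u l0 r0 _] := std_spec u_gt1.
rewrite (lyndon_brE u_gt1); set l := stdl u in Ll lt_lr def_u l0 *.
set r := stdr u in Lr lt_lr def_u r0 lt_rv *.
have lt_lv := lexlt_trans lt_lr lt_rv.
have step a b : lyndon a -> lyndon b -> lexlt a v -> lexlt b v ->
    perm_eq (a ++ b) u ->
    in_span (lower u v) (br (lyndon_br a) (br (lyndon_br b) (lyndon_br v))).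
  move=> La Lb lt_av lt_bv ab.
  have sz_ab : (size a + size b = size u)%N by rewrite -(perm_size ab) size_cat.
  have sza := lyndon_size La.
  have lt_szN : (size b + size v < N)%N by clear -sz sz_ab sza; lia.
  apply: (span_bind (cl_br_linearr _)) (IHN _ _ lt_szN Lb Lv) => z.
  case=> t [Lt pt lt_t ->].
  have lt_tv : lexlt t v by case/orP: lt_t => // /lexlt_trans; apply.
  have szt : size t = (size b + size v)%N by rewrite (perm_size pt) size_cat.
  have rka : (rank N a < rank N v)%N.
    by apply: rank_lt => //; clear -sz sz_ab; lia.
  have rkt : (rank N t < rank N v)%N.
    by apply: rank_lt => //; clear -szt lt_szN; lia.
  have sz_at : (size a + size t)%N = N by clear -sz sz_ab szt; lia.
  have := IHm a t (leq_trans rkt rk_v) (leq_trans rka rk_v) sz_at La Lt.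
  apply: span_mono => z' [s [Ls ps lt_s ->]]; exists s; split=> //.
    apply: (perm_trans ps); apply: (@perm_trans _ (a ++ (b ++ v))).
      by rewrite perm_cat2l.
    by rewrite catA perm_cat2r.
  by apply/orP; right; case/orP: lt_s => /lexlt_trans; apply.
have := cl_br_jacobi (lyndon_br v) (lyndon_br_comp l) (lyndon_br_comp r).
move/eqP; rewrite -subr_eq => /eqP <-.
apply: spanD; first by apply: step; rewrite // -def_u.
by apply/spanN/spanZ; apply: step; rewrite // perm_catC -def_u.
Qed.

(** The span of the Lyndon elements of the Lyndon rearrangements of [w]. *)
Definition lyndon_span w : L -> Prop :=
  in_span (fun z => exists t, [/\ lyndon t, perm_eq t w & z = lyndon_br t]).

Lemma lyndon_span_perm w w' z : perm_eq w w' -> lyndon_span w z -> lyndon_span w' z.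
Proof.
move=> ww'; apply: span_mono => y [t [Lt pt ->]]; exists t; split=> //.
exact: perm_trans ww'.
Qed.

Lemma ad_lyndon_span u w z : lyndon u -> lyndon_span w z ->
  lyndon_span (u ++ w) (br (lyndon_br u) z).
Proof.
move=> Lu; apply: span_bind; first exact: cl_br_linearr.
move=> _ [t [Lt pt ->]]; have := br_lyndon_lower Lu Lt.
apply: span_mono => y [s [Ls ps _ ->]]; exists s; split=> //.
by rewrite (perm_trans ps) // perm_cat2l.
Qed.

Lemma iter_ad_lyndon_span u m w z : lyndon u -> lyndon_span w z ->
  lyndon_span (wpow u m ++ w) (iter m (br (lyndon_br u)) z).
Proof.
move=> Lu Sz; elim: m => // m IH; rewrite wpowS -catA iterS.
exact: ad_lyndon_span.
Qed.

(** The iterated p-th power [(lyndon_br l)^[p^k]], attached to the word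
    [l^(p^k)]. *)
Fixpoint lyndon_pow l k : L :=
  if k is k'.+1 then clp_pmap (degw l ^+ (p ^ k'))%g (lyndon_pow l k')
  else lyndon_br l.

Lemma lyndon_pow_comp l k : cl_comp (degw (wpow l (p ^ k))) (lyndon_pow l k).
Proof.
rewrite degw_wpow; elim: k => [|k IH]; first by rewrite expn0 expg1; apply: lyndon_br_comp.
by rewrite expnSr expgM; apply: clp_pmap_comp.
Qed.

Lemma ad_lyndon_pow l k z :
  br (lyndon_pow l k) z = iter (p ^ k) (br (lyndon_br l)) z.
Proof.
elim: k z => // k IH z; have := lyndon_pow_comp l k; rewrite degw_wpow => comp_k.
rewrite /= (clp_pmap_ad _ comp_k) expnS iterM.
by apply: eq_iter => y; rewrite IH.
Qed.

(** Both brackets by p-powers expand into iterated brackets by Lyndon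
    elements; skew-symmetry brings the second one into this position. *)
Lemma br_lyndon_pow u j v k : lyndon u -> lyndon v ->
  lyndon_span (wpow u (p ^ j) ++ wpow v (p ^ k)) (br (lyndon_pow u j) (lyndon_pow v k)).
Proof.
move=> Lu Lv; rewrite ad_lyndon_pow.
have pj_gt0 : (0 < p ^ j)%N by rewrite expn_gt0 p_gt0.
rewrite -(prednK pj_gt0) iterSr; set m := (p ^ j).-1.
rewrite (cl_br_skew (lyndon_br_comp u) (lyndon_pow_comp v k)) ad_lyndon_pow.
apply: (@lyndon_span_perm (wpow u m ++ (wpow v (p ^ k) ++ u))).
  by rewrite -addn1 wpowD wpow1 -catA perm_cat2l perm_catC.
apply: iter_ad_lyndon_span => //; apply/spanN/spanZ/iter_ad_lyndon_span => //.
by apply: span_gen; exists u.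
Qed.

(** ** Gradings by weights *)

Section Weights.
Variables (W : Type) (op : W -> W -> W) (pw : W -> W) (wt : X -> W).
Variable omega : seq X -> W.
Hypothesis omega1 : forall x, omega [:: x] = wt x.
Hypothesis omega_cat : forall u v, omega (u ++ v) = op (omega u) (omega v).
Hypothesis omega_perm : forall u v, perm_eq u v -> omega u = omega v.
Hypothesis omega_deg : forall u v, omega u = omega v -> degw u = degw v.
Hypothesis pwE : forall a, pw a = iter p.-1 (op a) a.

Notation wcomp := (weight_comp op pw wt iota).

(** The span of the p-powers of Lyndon elements of weight [a]. *)
Definition weight_span (a : W) : L -> Prop :=
  in_span (fun z => exists l k, [/\ lyndon l, omega (wpow l (p ^ k)) = a & z = lyndon_pow l k]).

Lemma omega_wpow_p w : omega (wpow w p) = pw (omega w).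
Proof.
rewrite pwE -{1}(prednK p_gt0); elim: p.-1 => [|m IH]; first by rewrite wpow1.
by rewrite wpowS omega_cat IH.
Qed.

Lemma lyndon_weight_span w z : lyndon_span w z -> weight_span (omega w) z.
Proof.
apply: span_mono => y [t [Lt pt ->]]; exists t, 0%N; split=> //.
by rewrite expn0 wpow1; apply: omega_perm.
Qed.

Lemma br_weight_span a b x y : weight_span a x -> weight_span b y ->
  weight_span (op a b) (br x y).
Proof.
apply: span_bilinear => [z|z|]; [exact: cl_br_linearl|exact: cl_br_linearr|].
move=> _ _ [l [k [Ll <- ->]]] [m [j [Lm <- ->]]].
by rewrite -omega_cat; apply/lyndon_weight_span/br_lyndon_pow.
Qed.

Lemma weight_span_comp w x : weight_span (omega w) x -> cl_comp (degw w) x.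
Proof.
elim=> [|c u v [l [k [_ /omega_deg <- ->]]] _ IH]; first exact: comp0.
by apply: compD => //; apply: compZ; apply: lyndon_pow_comp.
Qed.

Lemma ad_coef_weight_span a x y k j : weight_span a x -> weight_span a y ->
  weight_span (iter k (op a) a) (ad_coef br x y x k j).
Proof.
move=> Sx Sy; elim: k j => [|k IH] j /=; first by case: ifP => //; constructor.
apply: spanD; last exact: br_weight_span.
by case: j => [|j]; [constructor | apply: br_weight_span].
Qed.

(** The terms of Jacobson's formula are iterated brackets of elements of weight
    [a], with [p] entries, hence of weight [pw a]. *)
Lemma pmap_weight_span w x : weight_span (omega w) x ->
  weight_span (pw (omega w)) (clp_pmap (degw w) x).
Proof.
elim=> [|c u v Qu Sv IH]; first by rewrite pmap0; constructor.
have Su : weight_span (omega w) u by apply: span_gen.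
have Scu : weight_span (omega w) (c *: u) by apply: spanZ.
rewrite (clp_pmapD (weight_span_comp Scu) (weight_span_comp Sv)).
rewrite (clp_pmapZ _ (weight_span_comp Su)).
apply: spanD; [apply: spanD => //; apply: spanZ | apply: span_sum => i _].
  have [l [k [Ll wl ->]]] := Qu; apply: span_gen; exists l, k.+1; split=> //.
    by rewrite expnSr wpowM omega_wpow_p wl.
  by rewrite -(omega_deg wl) degw_wpow.
by apply: spanZ; rewrite pwE; apply: ad_coef_weight_span.
Qed.

(** The component of weight [a] is spanned by the p-powers of Lyndon elements
    of weight [a]. *)
Lemma weight_comp_span a x : wcomp a x -> weight_span a x.
Proof.
elim=> {a x} [x|a|a c u v _ Su _ Sv|a b u v _ Su _ Sv|a g u gu _ Su].
- apply: span_gen; exists [:: x], 0%N; split=> //.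
  by rewrite expn0 wpow1.
- by constructor.
- by apply: spanD => //; apply: spanZ.
- exact: br_weight_span.
(* Unless [u = 0], the weight of [u] is that of a word, which determines its
   degree in [G]. *)
have [u0|[w def_a]] : u = 0 \/ exists w, a = omega w.
- by case: Su => [|c x y [l [k [_ <- _]]] _]; [left | right; eexists].
- by rewrite u0 pmap0; constructor.
rewrite def_a in Su *; have [->|ne] := eqVneq g (degw w); first exact: pmap_weight_span.
by rewrite (comp_unique gu (weight_span_comp Su) ne) pmap0; constructor.
Qed.

Lemma lyndon_br_weight w : w <> [::] -> wcomp (omega w) (lyndon_br w).
Proof.
elim/std_ind: w => // [x|w gt1 IHl IHr] w0.
  by rewrite omega1 lyndon_br1; constructor.
rewrite lyndon_brE //; have [def_w l0 r0 _] := std_spec gt1.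
by rewrite [in omega w]def_w omega_cat; constructor; auto.
Qed.

Lemma lyndon_pow_weight l k : lyndon l ->
  wcomp (omega (wpow l (p ^ k))) (lyndon_pow l k).
Proof.
move=> Ll; elim: k => [|k IH].
  by rewrite expn0 wpow1; apply/lyndon_br_weight/lyndon_neq0.
rewrite expnSr wpowM omega_wpow_p; constructor=> //.
by rewrite -degw_wpow; apply: lyndon_pow_comp.
Qed.

End Weights.
End LyndonSpan.

(** * Linear independence of the powers of Lyndon elements *)

Section Independence.
Variables (F : fieldType) (p : nat) (G : finGroupType) (gamma : G -> G -> F).
Hypothesis charF : p \in [pchar F].
Hypothesis abelG : abelian [set: G].
Hypothesis gamma_skew : skew_bicharacter gamma.
Hypothesis gamma_plus : forall h : G, gamma h h = 1.
Variables (X : finType) (deg : X -> G) (L : colorLieP p gamma) (iota : X -> L).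
Hypothesis freeL : is_free_clp deg iota.
Implicit Types (u v w s t l : seq X).

Let p_gt0 : (0 < p)%N. Proof. exact/prime_gt0/(pcharf_prime charF). Qed.
Let iota_deg x : cl_comp (deg x) (iota x). Proof. by case: freeL. Qed.

Section Model.
Variable N : nat.

Notation T := (N.-bseq X).
Let n := #|{: T}|.-1.

Let cardT : #|{: T}| = n.+1.
Proof. by rewrite prednK //; apply/card_gt0P; exists [bseq]. Qed.

(** Words of length at most [N] index the rows and columns. *)
Let idx (t : T) : 'I_n.+1 := cast_ord cardT (enum_rank t).
Let wd (i : 'I_n.+1) : T := enum_val (cast_ord (esym cardT) i).

Let idxK : cancel idx wd.
Proof. by move=> t; rewrite /wd /idx cast_ordK enum_rankK. Qed.
Let wdK : cancel wd idx.
Proof. by move=> i; rewrite /wd /idx enum_valK cast_ordKV. Qed.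

(** The degree of the basis vector indexed by a word is that of the word. *)
Let d i := degw deg (wd i).

(** Left multiplication by the letter [x], on the words of length at most
    [N]; words that become too long are sent to zero. *)
Let letter_mx (x : X) : 'M[F]_n.+1 :=
  \matrix_(i, j) (val (wd i) == x :: val (wd j))%:R.

(** The product of the matrices of the letters of [w]. *)
Let word_mx w : 'M[F]_n.+1 := \prod_(x <- w) letter_mx x.

Let word_mx_cat u v : word_mx (u ++ v) = word_mx u * word_mx v.
Proof. exact: big_cat. Qed.

(** A word of length at most [N] is read off the column of the empty word. *)
Let word_mx_entry w i : (size w <= N)%N ->
  word_mx w i (idx [bseq]) = (val (wd i) == w)%:R.
Proof.
elim: w i => [|x w IH] i szw.
  rewrite /word_mx big_nil mxE -(can_eq wdK) idxK.
  by rewrite -val_eqE.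
have szw' : (size w <= N)%N by apply: ltnW.
rewrite [word_mx _]big_cons -/(word_mx w) mxE (bigD1 (idx (Bseq szw'))) //= IH //.
rewrite idxK eqxx mulr1 mxE idxK big1 ?addr0 // => j ne.
rewrite IH //; case: eqP => [E|_]; last by rewrite mulr0.
by case/eqP: ne; rewrite -[LHS]wdK; congr idx; apply: val_inj.
Qed.

(** [u <= v] in the lexicographic order. *)
Let upper u v := (u == v) || lexlt u v.
(** The span of the matrices of the words satisfying [P]. *)
Let word_span (P : seq X -> Prop) : 'M[F]_n.+1 -> Prop :=
  in_span (fun A => exists2 t, P t & A = word_mx t).
(** The words of the length of [w] that are larger than [w], respectively at
    least [w]. *)
Let above w t := size t = size w /\ lexlt w t.
Let from w t := size t = size w /\ upper w t.

(** [A] is the sum of the word [w] and a combination of larger words of the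
    same length. *)
Let leading w A := word_span (above w) (A - word_mx w).

Let leading_from w A : leading w A -> word_span (from w) A.
Proof.
move=> lA; rewrite -[A](subrK (word_mx w)); apply: spanD.
  by apply: span_mono lA => _ [t [sz lt] ->]; exists t => //; split; rewrite // /upper lt orbT.
by apply: span_gen; exists w => //; split; rewrite // /upper eqxx.
Qed.

Let word_spanM (P Q R : seq X -> Prop) A B :
  (forall s t, P s -> Q t -> R (s ++ t)) ->
  word_span P A -> word_span Q B -> word_span R (A * B).
Proof.
move=> PQR; apply: (@span_bilinear F _ _ _ _ _ _ (fun A B : 'M[F]_n.+1 => A * B)).
- by move=> C a A' B'; rewrite mulrDl -scalerAl.
- by move=> C a A' B'; rewrite mulrDr -scalerAr.
move=> _ _ [s Ps ->] [t Qt ->]; rewrite -word_mx_cat; apply: span_gen.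
by exists (s ++ t) => //; apply: PQR.
Qed.

Let upper_cat u v s t : size s = size u -> upper u s -> upper v t ->
  upper (u ++ v) (s ++ t).
Proof.
move=> sz; rewrite {1 2}/upper => /predU1P[<-|lt]; last first.
  by move=> _; rewrite /upper lexlt_cat_size ?orbT // sz.
by rewrite /upper lexlt_cat2l => /predU1P[->|->]; rewrite ?eqxx ?orbT.
Qed.

Let leadingM u v A B : leading u A -> leading v B -> leading (u ++ v) (A * B).
Proof.
move=> lA lB; have fB := leading_from lB; rewrite /leading word_mx_cat.
have ->: A * B - word_mx u * word_mx v
    = (A - word_mx u) * B + word_mx u * (B - word_mx v).
  by rewrite mulrBl mulrBr addrA subrK.
apply: spanD; first apply: word_spanM lA fB => s t [szs lts] [szt _].
  by split; rewrite ?size_cat ?szs ?szt // lexlt_cat_size // szs.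
apply: (@word_spanM (eq u)) lB => [_ t <- [szt ltt]|].
  by split; rewrite ?size_cat ?szt // lexlt_cat2l.
by apply: span_gen; exists u.
Qed.

Let leading_exp w A m : leading w A -> leading (wpow w m) (A ^+ m).
Proof.
move=> lA; elim: m => [|m IH].
  by rewrite expr0 /leading /word_mx big_nil subrr; constructor.
by rewrite exprS wpowS; apply: leadingM.
Qed.

(** For the standard factorization [w = uv] of a Lyndon word, [uv < v < vu],
    so the second term of the color commutator does not disturb the leading
    word. *)
Let leading_br u v A B c : lyndon (u ++ v) -> u <> [::] -> v <> [::] ->
  leading u A -> leading v B -> leading (u ++ v) (A * B - c *: (B * A)).
Proof.
move=> /lyndonP[_ Luv] u0 v0 lA lB.
have lt_uv : lexlt (u ++ v) (v ++ u) by apply: lexlt_catr; apply: (Luv u).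
rewrite /leading addrAC; apply: spanD; first exact: leadingM.
apply/spanN/spanZ; apply: word_spanM (leading_from lB) (leading_from lA).
move=> s t [szs ups] [szt upt]; split; first by rewrite !size_cat szs szt addnC.
by case/predU1P: (upper_cat szs ups upt) => [<-//|/(lexlt_trans lt_uv)].
Qed.

(** The homomorphism from [L] given by the universal property. *)
Let model_hom : exists f : L -> 'M[F]_n.+1,
  [/\ linear f, forall h x, cl_comp h x -> mxhom d h (f x),
      forall x y, f (cl_br x y) = colorbr gamma d (f x) (f y),
      forall h x, cl_comp h x -> f (clp_pmap h x) = f x ^+ p
    & forall x, f (iota x) = letter_mx x].
Proof.
have letter_hom x : mxhom d (deg x) (letter_mx x).
  move=> i j; rewrite mxE; case: (val (wd i) =P _) => [E _|_]; last by rewrite eqxx.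
  by rewrite /d E /degw big_cons.
have [_ univ] := freeL.
have [f [[lin_f hom_f br_f pmap_f] f_iota _]] :=
  univ (mx_colorLieP charF abelG gamma_skew gamma_plus d) letter_mx letter_hom.
by exists f; split.
Qed.

Let leading_lyndon_pow (f : L -> 'M[F]_n.+1) :
  linear f -> (forall h x, cl_comp h x -> mxhom d h (f x)) ->
  (forall x y, f (cl_br x y) = colorbr gamma d (f x) (f y)) ->
  (forall h x, cl_comp h x -> f (clp_pmap h x) = f x ^+ p) ->
  (forall x, f (iota x) = letter_mx x) ->
  forall l k, lyndon l -> leading (wpow l (p ^ k)) (f (lyndon_pow deg iota l k)).
Proof.
move=> lin_f hom_f br_f pmap_f f_iota l k Ll.
have lead_l : leading l (f (lyndon_br iota l)).
  elim/std_ind: l Ll => // [x _|w gt1 IHl IHr Lw].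
    by rewrite lyndon_br1 f_iota /leading /word_mx big_seq1 subrr; constructor.
  rewrite lyndon_brE //; have [Ll Lr _] := std_lyndon Lw gt1.
  have [def_w l0 r0 _] := std_spec gt1; rewrite br_f.
  rewrite (colorbr_hom2 gamma (hom_f _ _ (lyndon_br_comp iota_deg _)) (hom_f _ _ (lyndon_br_comp iota_deg _))).
  by rewrite [X in leading X]def_w; apply: leading_br; rewrite -?def_w; auto.
have ->: f (lyndon_pow deg iota l k) = f (lyndon_br iota l) ^+ (p ^ k).
  elim: k => [|k IH]; first by rewrite expn0 expr1.
  rewrite /= (pmap_f _ _ _) ?IH -?exprM -?expnSr //.
  by rewrite -degw_wpow; apply: lyndon_pow_comp.
exact: leading_exp.
Qed.

(** The leading words of the [b u] with nonzero coefficient are the distinct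
    words [u]; the smallest such [u] cannot cancel in the sum. *)
Lemma lyndon_pow_indep (b : N.-tuple X -> L) (c : N.-tuple X -> F) :
  (forall u : N.-tuple X, c u != 0 -> exists l k,
     [/\ lyndon l, val u = wpow l (p ^ k) & b u = lyndon_pow deg iota l k]) ->
  \sum_(u : N.-tuple X) c u *: b u = 0 ->
  forall u : N.-tuple X, c u = 0.
Proof.
move=> b_pow sum0; have [f [lin_f hom_f br_f pmap_f f_iota]] := model_hom.
have lead_b (u : N.-tuple X) : c u != 0 -> leading u (f (b u)).
  by case/b_pow=> l [k [Ll -> ->]]; apply: leading_lyndon_pow.
have f0 : f 0 = 0 by have := lin_f (-1) 0 0; rewrite scaler0 addr0 scaleN1r addNr.
have fsum : f (\sum_(u : N.-tuple X) c u *: b u) = \sum_(u : N.-tuple X) c u *: f (b u).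
  elim/big_rec2: _ => [|u y x _ <-]; first exact: f0.
  by rewrite lin_f.
pose ix (u : N.-tuple X) := idx (bseq_of_tuple u).
have entry0 (u w : N.-tuple X) A : upper u w -> word_span (above w) A ->
    A (ix u) (idx [bseq]) = 0.
  move=> le_uw; elim=> [|a B C [t [szt lt_wt] ->] _ IH]; first by rewrite mxE.
  rewrite !mxE IH addr0 word_mx_entry ?szt ?size_tuple // idxK /=.
  case: eqP => [E|_]; last by rewrite mulr0.
  move: le_uw lt_wt; rewrite -E /upper => /predU1P[->|lt1 lt2]; first by rewrite lexlt_irr.
  by have := lexlt_trans lt1 lt2; rewrite lexlt_irr.
have entry (u w : N.-tuple X) : c w != 0 -> upper u w ->
    f (b w) (ix u) (idx [bseq]) = (u == w)%:R.
  move=> /lead_b lw le_uw; have := entry0 u w _ le_uw lw.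
  rewrite !mxE => /eqP; rewrite subr_eq0 => /eqP->.
  by rewrite word_mx_entry ?size_tuple // idxK.
pose rank (u : N.-tuple X) := #|[set t : N.-tuple X | lexlt t u]|.
move=> u; have [m] := ubnP (rank u); elim: m u => // m IH u; rewrite ltnS => rk_u.
have IHu (w : N.-tuple X) : lexlt w u -> c w = 0.
  move=> lt_wu; apply: IH; apply: leq_trans rk_u; apply/proper_card/properP; split.
    by apply/subsetP=> t; rewrite !inE => /lexlt_trans; apply.
  by exists w; rewrite !inE ?lexlt_irr.
have /matrixP/(_ (ix u) (idx [bseq])) : f (\sum_(u : N.-tuple X) c u *: b u) = 0 by rewrite sum0.
rewrite fsum summxE mxE (bigD1 u) //= big1 ?addr0 => [|w ne].
  rewrite mxE; have [->//|nz] := eqVneq (c u) 0.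
  by rewrite entry ?eqxx ?mulr1 // /upper eqxx.
rewrite mxE; have [->|nz] := eqVneq (c w) 0; first by rewrite mul0r.
rewrite entry //; first by rewrite eq_sym (negPf ne) mulr0.
by case: (lexlt_total u w) => [/val_inj E|lt|/IHu c0];
  rewrite /upper ?lt ?orbT // ?E ?eqxx // c0 eqxx in nz *.
Qed.

End Model.

(** ** Bases of the weight components *)

(** The basis element attached to the word [u = l^(p^k)]. *)
Definition ppow_elt u : L :=
  let k := find (fun k => lyndon_power (p ^ k) u) (seq.iota 0 (size u).+1) in
  lyndon_pow deg iota (take (size u %/ p ^ k) u) k.

Let pX_gt0 k : (0 < p ^ k)%N. Proof. by rewrite expn_gt0 p_gt0. Qed.

Lemma ppow_lyndonP u : ppow_lyndon p u -> exists l k,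
  [/\ lyndon l, u = wpow l (p ^ k) & ppow_elt u = lyndon_pow deg iota l k].
Proof.
move=> Pu; set k := find (fun k => lyndon_power (p ^ k) u) (seq.iota 0 (size u).+1).
exists (take (size u %/ p ^ k) u), k.
have ltk : (k < (size u).+1)%N by rewrite -[X in (_ < X)%N](size_iota 0) -has_find.
by have := nth_find 0%N Pu; rewrite nth_iota // add0n => /andP[? /eqP ?]; split.
Qed.

Lemma ppow_lyndon_wpow l k : lyndon l -> ppow_lyndon p (wpow l (p ^ k)).
Proof.
move=> Ll; apply/hasP; exists k; last exact: lyndon_power_wpow.
rewrite mem_iota /= add0n ltnS size_wpow.
apply: leq_trans (leq_pmulr _ (lyndon_size Ll)).
by apply/ltnW/ltn_expl/prime_gt1/(pcharf_prime charF).
Qed.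

Lemma ppow_elt_wpow l k : lyndon l ->
  ppow_elt (wpow l (p ^ k)) = lyndon_pow deg iota l k.
Proof.
move=> Ll; have [m [j [Lm E ->]]] := ppow_lyndonP (ppow_lyndon_wpow k Ll).
have [-> /eqP] := wpow_lyndon_inj Ll Lm (pX_gt0 _) (pX_gt0 _) E.
by rewrite eqn_exp2l ?(prime_gt1 (pcharf_prime charF)) // => /eqP->.
Qed.

(** In a grading by weights for which the words of weight [a] have a common
    length, the basis elements attached to these words form a basis of the
    component of weight [a]. *)
Lemma weight_comp_dim (W : Type) (op : W -> W -> W) (pw : W -> W) (wt : X -> W)
    (omega : seq X -> W) (a : W) (N : nat) (A : pred (N.-tuple X)) :
  (forall x, omega [:: x] = wt x) ->
  (forall u v, omega (u ++ v) = op (omega u) (omega v)) ->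
  (forall u v, perm_eq u v -> omega u = omega v) ->
  (forall u v, omega u = omega v -> degw deg u = degw deg v) ->
  (forall b, pw b = iter p.-1 (op b) b) ->
  (forall u, omega u = a -> size u = N) ->
  (forall u : N.-tuple X, reflect (omega u = a) (A u)) ->
  has_dim (weight_comp op pw wt iota a)
    #|[set u : N.-tuple X | ppow_lyndon p u && A u]|.
Proof.
move=> omega1 omega_cat omega_perm omega_deg pwE omega_size AP.
set S := [set u : N.-tuple X | _]; pose b (i : 'I_#|S|) := ppow_elt (enum_val i).
have valS i : ppow_lyndon p (enum_val i : N.-tuple X) && A (@enum_val _ (mem S) i).
  by have := enum_valP i; rewrite inE.
exists b; split=> [i|c sum0 i|v /(weight_comp_span charF iota_deg omega1
    omega_cat omega_perm omega_deg pwE)].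
- have /andP[/ppow_lyndonP[l [k [Ll def_u def_b]]] Ai] := valS i.
  rewrite /b def_b -(elimT (AP _) Ai) def_u.
  exact: (lyndon_pow_weight charF iota_deg omega1 omega_cat pwE).
- pose c' (u : N.-tuple X) := \sum_(i | enum_val i == u) c i.
  have c'_enum : c' (enum_val i) = c i.
    by rewrite /c' (big_pred1 i) // => j; rewrite (inj_eq enum_val_inj).
  rewrite -c'_enum; apply: (@lyndon_pow_indep N (fun u : N.-tuple X => ppow_elt u) c') => [u nz|].
    have [l [k [Ll def_u def_b]]] : exists l k, [/\ lyndon l, val u = wpow l (p ^ k)
        & ppow_elt u = lyndon_pow deg iota l k].
      apply/ppow_lyndonP; have [j /eqP <-|no] := pickP [pred j : 'I_#|S| | enum_val j == u].
        by case/andP: (valS j).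
      by rewrite /c' big_pred0 ?eqxx in nz.
    by exists l, k.
  rewrite -[RHS]sum0 (partition_big (fun j : 'I_#|S| => enum_val j) xpredT) //=.
  apply: eq_bigr => u _; rewrite scaler_suml; apply: eq_bigr => j /eqP def_u.
  by rewrite /b def_u.
elim=> [|x _ v' [l [k [Ll wl ->]]] _ [c ->]].
  by exists (fun _ => 0); rewrite big1 // => i _; rewrite scale0r.
have [t def_t] : exists t : N.-tuple X, tval t = wpow l (p ^ k).
  by exists (Tuple (introT eqP (omega_size _ wl))).
have tS : t \in S.
  rewrite inE def_t ppow_lyndon_wpow //=.
  by apply/AP; rewrite def_t.
exists (fun i => (if i == enum_rank_in tS t then x else 0) + c i).
under [RHS]eq_bigr => i _ do rewrite scalerDl.
rewrite big_split /=; congr (_ + _).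
rewrite (bigD1 (enum_rank_in tS t)) //= eqxx big1 ?addr0 => [|i ne].
  by rewrite /b enum_rankK_in // def_t ppow_elt_wpow.
by rewrite (negPf ne) scale0r.
Qed.

End Independence.

(** * Dimensions of the components of a free color Lie p-algebra *)

Section Dimensions.
Variables (p r : nat) (G : finGroupType) (g : 'I_r -> G) (X : finType) (deg : X -> G).
Hypothesis abelG : abelian [set: G].
Variable col : X -> 'I_r.
Hypothesis deg_col : forall x, deg x = g (col x).

(** The degree of a word is determined by its content. *)
Lemma degw_cont u : degw deg u = (\prod_(i < r) g i ^+ cont col u i)%g.
Proof.
have mulGC (h k : G) : (h * k = k * h)%g by apply: (centsP abelG); rewrite inE.
have prodM (f1 f2 : 'I_r -> G) :
    (\prod_i (f1 i * f2 i) = (\prod_i f1 i) * (\prod_i f2 i))%g.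
  elim/big_rec3: _ => [|i a b c _ ->]; first by rewrite mulg1.
  by rewrite -!mulgA; congr (_ * _)%g; rewrite !mulgA [(f2 i * _)%g]mulGC.
elim: u => [|x u IH].
  by rewrite /degw big_nil big1 // => i _; rewrite cont_nil mnm0E expg0.
rewrite /degw big_cons -/(degw deg u) IH cont_cons.
under [RHS]eq_bigr => i _ do rewrite mnmDE expgD.
rewrite prodM; congr (_ * _)%g.
rewrite (@big_only1 _ _ _ _ (col x)) // ?mnm1E ?eqxx // => i ne _.
by rewrite mnm1E eq_sym (negPf ne).
Qed.

Lemma iter_mnm_add (a : 'X_{1..r}) m : iter m (fun b => (a + b)%MM) a = (a *+ m.+1)%MM.
Proof.
elim: m => [|m /= ->]; first by apply/mnmP=> i; rewrite mulmnE muln1.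
by apply/mnmP=> i; rewrite mnmDE !mulmnE mulnS.
Qed.

(** The words of length [n] and degree [h], sorted by content. *)
Lemma card_ppow_lyndon_deg n h :
  #|[set u : n.-tuple X | ppow_lyndon p u && (degw deg u == h)]|
  = (\sum_(a : 'X_{1..r < n.+1} |
       (mdeg a == n) && ((\prod_(i < r) g i ^+ a i)%g == h)) num_ppow_lyndon col p a)%N.
Proof.
have cont_lt (u : n.-tuple X) : (mdeg (cont col u) < n.+1)%N by rewrite mdeg_cont size_tuple.
pose c u : 'X_{1..r < n.+1} := BMultinom (cont_lt u).
rewrite -sum1_card (partition_big c (fun a : 'X_{1..r < n.+1} =>
  (mdeg a == n) && ((\prod_(i < r) g i ^+ a i)%g == h))) /=; last first.
  move=> u; rewrite inE => /andP[_ /eqP <-].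
  by rewrite degw_cont mdeg_cont size_tuple !eqxx.
apply: eq_bigr => a /andP[/eqP def_n /eqP def_h].
have -> : num_ppow_lyndon col p a
    = #|[set u : n.-tuple X | ppow_lyndon p u && (cont col u == a)]|.
  by rewrite /num_ppow_lyndon def_n.
rewrite -sum1_card; apply: eq_bigl => u; rewrite !inE -andbA; congr (_ && _).
rewrite -val_eqE /=; apply: andb_idl => /eqP Eu.
by rewrite degw_cont Eu def_h.
Qed.

End Dimensions.

Theorem theorem2p5p12 (p : nat) (F : fieldType) (G : finGroupType)
  (gamma : G -> G -> F) (r : nat) (g : 'I_r -> G) (s : 'I_r -> nat)
  (X : finType) (deg : X -> G) (L : colorLieP p gamma) (iota : X -> L)
  (charF : p \in [pchar F])
  (abelG : abelian [set: G])
  (gamma_skew : skew_bicharacter gamma)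
  (gamma_plus : forall h : G, gamma h h = 1)
  (g_bij : bijective g)
  (s_card : forall i : 'I_r, #|[set x : X | deg x == g i]| = s i)
  (s_pos : forall i : 'I_r, (1 <= s i)%N)
  (freeL : is_free_clp deg iota) :
  exists dimL : 'X_{1..r} -> nat,
    [/\ forall a : 'X_{1..r}, a != 0%MM ->
          has_dim (multidegree_comp deg iota g a) (dimL a),
        series_sum1
          (fun n a => - ((mobius_p p n)%:~R / n%:R
             * log1m (\sum_(i < r) (s i)%:R *: ('X_i ^+ n : {mpoly rat[r]})) a))
          (hilbert_series dimL),
        forall a : 'X_{1..r}, a != 0%MM ->
          (dimL a)%:R = ((mdeg a)%:R : rat)^-1 *
            \sum_(1 <= n < (mdeg a).+1 | [forall i : 'I_r, (n %| a i)%N])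
              (mobius_p p n)%:~R
              * (((mdeg a %/ n)`!)%:R / \prod_(i < r) ((a i %/ n)`!)%:R)
              * \prod_(i < r) (s i)%:R ^+ (a i %/ n)
      & forall (n : nat) (h : G), (1 <= n)%N ->
          has_dim (degree_comp deg iota (n, h))
            (\sum_(a : 'X_{1..r < n.+1} |
                 (mdeg a == n) && ((\prod_(i < r) g i ^+ a i)%g == h))
               dimL a)%N].
Proof.
have p_pr := pcharf_prime charF; have p_gt0 := prime_gt0 p_pr.
have [ginv gK ginvK] := g_bij.
pose col x := ginv (deg x).
have deg_col x : deg x = g (col x) by rewrite /col ginvK.
have colE x i : (deg x == g i) = (col x == i).
  by rewrite deg_col (inj_eq (can_inj gK)).
have col_card i : #|[set x | col x == i]| = s i.
  by rewrite -s_card; apply: eq_card => x; rewrite !inE colE.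
have dimE a : a != 0%MM -> (num_ppow_lyndon col p a)%:R
    = ((mdeg a)%:R : rat)^-1 *
      \sum_(1 <= n < (mdeg a).+1 | mdvd n a)
        (mobius_p p n)%:~R * multinomial s (mdiv a n).
  move=> a0; have n0 : (mdeg a)%:R != 0 :> rat by rewrite pnatr_eq0 mdeg_eq0.
  apply: (mulfI n0); rewrite mulrA mulfV // mul1r -natrM.
  have := congr1 (fun z : int => z%:~R : rat) (num_ppow_lyndon_inversion col p_pr a0).
  rewrite /= -[X in X = _]pmulrn => ->; rewrite rmorph_sum /= big_geq_mkord /=.
  apply: eq_big => [n|n _]; first by rewrite andbC.
  by rewrite rmorphM /= -(num_words_multinomial col_card).
exists (num_ppow_lyndon col p); split.
- move=> a a0; apply: (weight_comp_dim charF abelG gamma_skew gamma_plus freeL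
    (omega := cont col) (A := fun u => cont col u == a)).
  + by move=> x; apply/mnmP=> i; rewrite contE !mnmE /= colE addn0.
  + exact: cont_cat.
  + exact: cont_perm.
  + by move=> u v E; rewrite !(degw_cont abelG deg_col) E.
  + by move=> b; rewrite iter_mnm_add prednK.
  + by move=> u <-; rewrite mdeg_cont.
  + by move=> u; apply: eqP.
- move=> a; exists (mdeg a).+1 => M le_aM; rewrite /hilbert_series.
  have [->|a0] := eqVneq a 0%MM.
    by rewrite big1 // => n _; rewrite /log1m mdeg0 big_geq // oppr0 mulr0 oppr0.
  have termE n : (0 < n)%N -> - ((mobius_p p n)%:~R / n%:R
        * log1m (\sum_(i < r) (s i)%:R *: ('X_i ^+ n : {mpoly rat[r]})) a)
      = if mdvd n a then ((mdeg a)%:R : rat)^-1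
          * ((mobius_p p n)%:~R * multinomial s (mdiv a n)) else 0.
    move=> n0; rewrite (log1m_upoly col_card n0 a0).
    case: ifP => _; last by rewrite mulr0 oppr0.
    have nz : n%:R != 0 :> rat by rewrite pnatr_eq0 -lt0n.
    have dz : (mdeg a)%:R != 0 :> rat by rewrite pnatr_eq0 mdeg_eq0.
    move: (mobius_p p n)%:~R (multinomial _ _) n%:R (mdeg a)%:R nz dz => c d N K nz dz.
    by field; rewrite nz dz.
  rewrite dimE // big_distrr /= [RHS]big_mkcond /=.
  rewrite big_nat_cond (eq_bigr (fun n => if mdvd n a then ((mdeg a)%:R : rat)^-1
          * ((mobius_p p n)%:~R * multinomial s (mdiv a n)) else 0)); last first.
    by move=> n /andP[/andP[n0 _] _]; apply: termE.
  rewrite -big_nat_cond (@big_cat_nat _ _ _ (mdeg a).+1) //=.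
  rewrite [X in _ + X]big_nat_cond [X in _ + X]big1 ?addr0 // => n.
  rewrite andbT => /andP[ltn _]; case: ifP => // /(mdvd_leq a0).
  by rewrite leqNgt ltn.
- move=> a a0; rewrite dimE //; congr (_ * _).
  rewrite big_nat_cond [RHS]big_nat_cond.
  apply: eq_bigr => n /andP[/andP[n0 _] na].
  rewrite /multinomial mdeg_mdiv // mulrA; congr (_ * (_ / _) * _).
    by apply: eq_bigr => i _; rewrite mdivE.
  by apply: eq_bigr => i _; rewrite mdivE.
- move=> n h n_gt0; rewrite -(card_ppow_lyndon_deg p abelG deg_col).
  apply: (weight_comp_dim charF abelG gamma_skew gamma_plus freeL
    (omega := fun u => (size u, degw deg u)) (A := fun u => degw deg u == h)).
  + by move=> x; rewrite /degw big_seq1.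
  + by move=> u v; rewrite size_cat degw_cat.
  + by move=> u v uv; rewrite (perm_size uv) (degw_perm abelG deg uv).
  + by move=> u v [].
  + move=> [m k] /=; rewrite -{1 2}(prednK p_gt0).
    elim: p.-1 => [|j IH] /=; first by rewrite mul1n expg1.
    by rewrite -IH /= mulSn expgS.
  + by move=> u [].
  + move=> u; rewrite size_tuple; apply: (iffP eqP) => [->//|[]//].
Qed.
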